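(* Let $d\ge 1$, $\lambda>0$, let $\mu_1$ be the Cauchy distribution with density $g(x)=\frac{1}{\pi}\frac{\lambda}{x^2+\lambda^2}$, let $\mu_2$ be any probability measure on $\mathbb{R}$, and let $\mu=\mu_1*\mu_2$. Let $\rho$ be the density of states function of the Anderson model $H^\omega$ on $\ell^2(\mathbb{Z}^d)$ with single site distribution $\mu$, and let $\nu_2$ be the density of states measure of the Anderson model $h^{\omega_2}$ on $\ell^2(\mathbb{Z}^d)$ with single site distribution $\mu_2$. Then $$\rho(x)=(g*\nu_2)(x)=\int_{\mathbb{R}}g(x-y)\,d\nu_2(y),$$ and in particular $\rho$ is infinitely differentiable.
   Context: Anderson model with single site distribution (SSD) $\kappa$ (a probability measure on $\mathbb{R}$): the random self-adjoint operator $\Delta+V^\omega$ on $\ell^2(\mathbb{Z}^d)$, where $(\Delta u)(n)=\sum_{|k-n|=1}u(k)$ and $(V^\omega u)(n)=\omega_n u(n)$, with $\{\omega_n\}_{n\in\mathbb{Z}^d}$ i.i.d. real random variables of law $\kappa$. Density of states measure: let $\Lambda_L=\{n\in\mathbb{Z}^d:|n_i|\le L,\ 1\le i\le d\}$, let $\chi_L$ be the orthogonal projection onto $\ell^2(\Lambda_L)$, $H^\omega_L=\chi_L H^\omega\chi_L$, and let $\mathcal{N}^\omega_L(E)$ be the number of eigenvalues of $H^\omega_L$ that are $\le E$, counted with multiplicity. The integrated density of states is the (nonrandom) limit $\mathcal{N}(E)=\lim_{L\to\infty}(2L+1)^{-d}\mathcal{N}^\omega_L(E)$ for a.e. $\omega$,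 and the density of states measure (DOSm) $\nu$ is the probability measure with $\nu(-\infty,E]=\mathcal{N}(E)$; equivalently $\nu(B)=\mathbb{E}\langle e_0,E_{H^\omega}(B)e_0\rangle$ with $E_{H^\omega}$ the spectral measure of $H^\omega$. When $\nu$ is absolutely continuous, as it is for SSD $\mu_1*\mu_2$, its Lebesgue density $\rho$ is called the density of states function (DOSf). As a density, $\rho$ is determined up to Lebesgue-null sets; the claim is that $g*\nu_2$ is a version of it. *)

(* Defs.v *)
From HB Require Import structures.
From mathcomp Require Import all_boot all_order all_algebra finmap.
From mathcomp Require Import all_classical all_reals all_analysis.

Set Implicit Arguments.
Unset Strict Implicit.
Unset Printing Implicit Defensive.

Import Order.TTheory GRing.Theory Num.Theory.
Import numFieldNormedType.Exports.

Local Open Scope classical_set_scope.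
Local Open Scope ring_scope.

Notation lattice d := ('rV[int]_d).

Section Operator.
Context {R : realType} {d : nat}.

(* |k - n| is the Euclidean distance; it equals 1 iff its square does. *)
Definition nearest_neighbor (n k : lattice d) : bool :=
  \sum_(i < d) (k 0 i - n 0 i) ^+ 2 == 1.

Definition lattice_laplacian (u : lattice d -> R) (n : lattice d) : R :=
  \sum_(k \in [set k | nearest_neighbor n k]) u k.

Definition anderson (v u : lattice d -> R) (n : lattice d) : R :=
  lattice_laplacian u n + v n * u n.

Definition std_basis (k : lattice d) : lattice d -> R :=
  fun n => (n == k)%:R.

(* Lambda_L is enumerated by its coordinates shifted by L, which range over
   {0, ..., 2L}. *)
Definition box (L : nat) := {ffun 'I_d -> 'I_L.*2.+1}.

Definition box_site (L : nat) (c : box L) : lattice d :=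
  \row_i ((c i)%:Z - L%:Z).

(* The matrix of chi_L H chi_L on l^2(Lambda_L) in the basis (e_n). *)
Definition box_hamiltonian (v : lattice d -> R) (L : nat) : 'M[R]_#|box L| :=
  \matrix_(i, j) anderson v (std_basis (box_site (enum_val j)))
                            (box_site (enum_val i)).

End Operator.

(* For symmetric A, the multiplicity of an eigenvalue is the dimension of its
   eigenspace (MathComp eigenspaces consist of row vectors). *)
Definition eigenvalue_count {R : realType} {m : nat} (A : 'M[R]_m) (E : R)
    : nat :=
  \sum_(a \in [set a | eigenvalue A a /\ a <= E]) \rank (eigenspace A a).

Section Model.
Context {R : realType} {dO : measure_display} {Omega : measurableType dO}.

Definition mutually_independent {I : choiceType} (P : probability Omega R)
    (X : I -> {RV P >-> R}) : Prop :=
  forall (J : {fset I}) (B : I -> set R),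
    (forall i, i \in J -> measurable (B i)) ->
    P (\bigcap_(i in [set` J]) (X i @^-1` B i)) =
    (\prod_(i <- J) P (X i @^-1` B i))%E.

Definition iid_with_law {I : choiceType} (P : probability Omega R)
    (X : I -> {RV P >-> R}) (kappa : set R -> \bar R) : Prop :=
  mutually_independent X /\
  (forall i (B : set R), measurable B -> distribution P (X i) B = kappa B).

Definition is_dos_measure {d : nat} (P : probability Omega R)
    (omega : lattice d -> {RV P >-> R}) (nu : probability R R) : Prop :=
  forall E : R, {ae P, forall w : Omega,
    (fun L : nat =>
       (eigenvalue_count (box_hamiltonian (fun n => omega n w) L) E)%:R
         / (L.*2.+1 ^ d)%:R : R)
      @ \oo --> fine (nu `]-oo, E]%classic)}.

End Model.

Section Distributions.
Context {R : realType}.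

Definition convolution (mu1 mu2 : probability R R) : set R -> \bar R :=
  pushforward (mu1 \x mu2)%E (fun p : R * R => p.1 + p.2).

Definition has_density (nu : probability R R) (f : R -> R) : Prop :=
  [/\ measurable_fun [set: R] f, (forall x, 0 <= f x) &
      forall B : set R, measurable B ->
        nu B = (\int[lebesgue_measure]_(x in B) (f x)%:E)%E].

Definition cauchy_pdf (lambda x : R) : R :=
  pi^-1 * (lambda / (x ^+ 2 + lambda ^+ 2)).

Definition convolve (g : R -> R) (nu : probability R R) (x : R) : R :=
  \int[nu]_y g (x - y).

Definition infinitely_differentiable (f : R -> R) : Prop :=
  forall (n : nat) (x : R), derivable (derive1n n f) x 1.

End Distributions.

(* Main.v *)
(* Let [E] be an energy and [eta > 0].  In the box [Lambda_L], the imaginary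
   part of the trace of the resolvent of [H_L] at [E + i eta] is, as a function
   of a single [omega_n], the imaginary part of a Moebius function
   [c + b / (omega_n - w)] with [Im w > 0] (Sherman-Morrison).  This function is
   holomorphic and bounded on the lower half plane, so averaging it over a
   Cauchy variable of scale [lambda] amounts to replacing that variable by
   [- i lambda].  Doing so at every site trades the Cauchy part of the single
   site distribution for a shift of the energy from [E + i eta] to
   [E + i (eta + lambda)].  Divided by [#Lambda_L] and as [L] tends to infinity,
   this says that the Poisson transform of [nu] at height [eta] is the one of
   [nu_2] at height [eta + lambda]; letting [eta] tend to 0 (Stieltjes
   inversion), [nu] has density [g * nu_2]. *)

Require Import Defs.
From HB Require Import structures.
From mathcomp Require Import all_boot all_order all_algebra finmap.
From mathcomp Require Import all_classical all_reals all_analysis.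
From mathcomp Require Import measurable_realfun complex ring lra.

Import Order.TTheory GRing.Theory Num.Theory.
Import numFieldNormedType.Exports.

Set Implicit Arguments.
Unset Strict Implicit.
Unset Printing Implicit Defensive.

Local Open Scope classical_set_scope.
Local Open Scope ring_scope.
Local Notation Im := complex.Im.
Local Notation Re := complex.Re.

(** * Integration against a Cauchy density *)

(** Holomorphy enters only through explicit formulas: the average over a Cauchy variable is computed
    from a primitive on the real line, and its agreement with the value at [- i lambda] is an
    algebraic identity. Traces at potentials of negative imaginary part have nonnegative imaginary
    part, so Tonelli suffices to reorder their averages.

    The exchange passes through systems in which only some sites are already complex; hence matrices
    with a separate complex energy at each site.

    The two models live on unrelated probability spaces and the exchange equates expectations,
    whereas a density of states measure is given by almost sure convergence of counting functions,
    energy by energy. The Lorentz kernel is therefore approximated uniformly by step functions with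
    countably many thresholds, and dominated convergence, with bound [eta^-1], carries the limit
    over to expectations.

    In the inversion, the kernel integrated over an energy window tends to an indicator with half
    weights at the end points; atoms of [nu] must be excluded before these weights can be
    ignored. *)

Section Density.
Variable R : realType.
Local Notation leb := (@lebesgue_measure R).

(* [lebesgue_measure] lives on [measurableTypeR R], whose display differs from
   the one of the canonical measurable structure of [R]. *)
Definition to_measurableTypeR (x : R) : measurableTypeR R := x.

Lemma measurable_to_measurableTypeR : measurable_fun setT to_measurableTypeR.
Proof. by move=> _ B mB; rewrite setTI. Qed.

HB.instance Definition _ := isMeasurableFun.Build _ _ _ _ to_measurableTypeR
  measurable_to_measurableTypeR.

(** [has_density] only gives values on sets; they force [mu] to be dominated by Lebesgue measure and
    [g] to agree almost everywhere with the Radon-Nikodym derivative, after which the change of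
    variables applies. The latter asks for an integrable integrand, whence the finiteness
    hypothesis. *)
Lemma ge0_integral_density (mu : probability R R) (g : R -> R) (f : R -> \bar R) :
  has_density mu g -> measurable_fun [set: R] f -> (forall x, 0 <= f x)%E ->
  (\int[mu]_x f x < +oo)%E ->
  (\int[mu]_x f x = \int[leb]_x (f x * (g x)%:E))%E.
Proof.
move=> [mg g0 mug] mf f0 foo.
pose mu' : probability (measurableTypeR R) R := distribution mu to_measurableTypeR.
have mu'E : (\int[mu]_x f x = \int[mu']_x f x)%E.
  by rewrite ge0_integral_pushforward.
have mf' : measurable_fun [set: measurableTypeR R] f by [].
have intf : mu'.-integrable setT f.
  apply/integrableP; split => //.
  by under eq_integral do rewrite gee0_abs //; rewrite -mu'E.
have dom : mu' `<< leb.
  apply/null_content_dominatesP => A mA A0.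
  have -> : mu' A = mu A by [].
  by rewrite mug // null_set_integral //; exact/measurable_funTS/measurable_EFinP.
rewrite mu'E -(Radon_Nikodym_change_of_variables dom) //.
apply: ae_eq_integral => //.
- apply: emeasurable_funM; first exact: measurable_int intf.
  by apply: (@measurable_int _ _ _ leb); exact: Radon_Nikodym_integrable.
- apply: emeasurable_funM; first exact: measurable_int intf.
  exact/measurable_EFinP.
- apply: ae_eqe_mul2l.
  apply: integral_ae_eq => //.
  + exact: Radon_Nikodym_integrable.
  + exact/measurable_EFinP.
  + move=> A _ mA; rewrite -Radon_Nikodym_integral //.
    exact: (mug A mA).
Qed.

(** The line is cut at 0 and its negative half reflected, so that the half-line fundamental theorem
    serves twice; the limit at minus infinity is accordingly stated for [F (- x)]. *)
Lemma ge0_integral_FTC_line (f F : R -> R) (a b : R) :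
  (forall x, 0 <= f x) -> continuous f ->
  (forall x : R, is_derive x (1 : R) F (f x)) ->
  F x @[x --> +oo] --> b -> F (- x) @[x --> +oo] --> a ->
  (\int[leb]_x (f x)%:E = (b - a)%:E)%E.
Proof.
move=> f0 cf dF Fb Fa.
have mf : measurable_fun setT f by exact: continuous_measurable_fun.
have cF : continuous F.
  by move=> x; apply/differentiable_continuous/derivable1_diffP; have [] := dF x.
have cN : continuous (fun x : R => - x) by exact: opp_continuous.
have dFN (x : R) : is_derive x (1 : R) (fun x => - F (- x)) (f (- x)).
  have := is_derive1_comp (dF (- x)) (is_deriveN (is_derive_id x (1 : R))).
  by move=> /is_deriveN; rewrite mulrN1 opprK.
have half (h H : R -> R) (c : R) : (forall x, 0 <= h x) -> continuous h ->
    (forall x : R, is_derive x (1 : R) H (h x)) -> H x @[x --> +oo] --> c ->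
    (\int[leb]_(x in `[0%R, +oo[) (h x)%:E = c%:E - (H 0)%:E)%E.
  move=> h0 ch dH Hc; apply: ge0_continuous_FTC2y => //.
  - by move=> x; apply: continuous_subspaceT.
  - apply: cvg_at_right_filter.
    by apply/differentiable_continuous/derivable1_diffP; have [] := dH 0.
  - by move=> x _; rewrite derive1E; have [_] := dH x.
rewrite -(itv_setU_setT true 0) ge0_integral_setU //=; last 3 first.
- exact/measurable_funTS/measurable_EFinP.
- by move=> x _; rewrite lee_fin.
- rewrite disj_set2E; apply/eqP; rewrite -subset0 => x /= [].
  by rewrite !in_itv /= andbT => x0; rewrite leNgt x0.
rewrite (half f F b) // addrC.
have : (\int[leb]_(x in `]-oo, 0%R[) (f x)%:E = \int[leb]_(x in `[0%R, +oo[) (f (- x))%:E)%E.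
  rewrite (@ge0_integration_by_substitution0 _ (fun x => (f (- x))%:E)) //; last 2 first.
  - by apply/measurable_EFinP; apply: (measurableT_comp mf); exact: continuous_measurable_fun.
  - by move=> r; rewrite lee_fin.
  under [RHS]eq_integral do rewrite opprK.
  rewrite integral_itv_bndo_bndc //.
  exact/measurable_funTS/measurable_EFinP.
move=> ->; rewrite (half (fun x => f (- x)) (fun x => - F (- x)) (- a)) //.
- by rewrite oppr0 -!EFinB -EFinD; congr EFin; ring.
- by move=> x; apply: continuous_comp; [exact: cN|exact: cf].
- exact: cvgN.
Qed.

End Density.

Section Cauchy.
Variable R : realType.
Implicit Types (x u v s a b : R).
Local Notation leb := (@lebesgue_measure R).

Lemma sqrDsqr_gt0 x v : 0 < v -> 0 < x ^+ 2 + v ^+ 2.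
Proof. by move=> v0; rewrite ltr_wpDl ?sqr_ge0 ?exprn_gt0. Qed.

Lemma cvgy0_le_div (f : R -> R) C :
  (forall x, 1 <= x -> `|f x| <= C / x) -> f x @[x --> +oo] --> 0.
Proof.
move=> fC; apply/cvgrPdist_le => e e0; near=> x.
rewrite sub0r normrN.
have x1 : 1 <= x by near: x; apply: nbhs_pinfty_ge; exact: num_real.
have xC : C / e <= x by near: x; apply: nbhs_pinfty_ge; exact: num_real.
rewrite (le_trans (fC _ x1)) // ler_pdivrMr ?(lt_le_trans ltr01) //.
by rewrite mulrC -ler_pdivrMr.
Unshelve. all: by end_near. Qed.

Lemma cvgy_affine_div s a b : 0 < s ->
  (a * x + b) / (x ^+ 2 + s ^+ 2) @[x --> +oo] --> 0.
Proof.
move=> s0; apply: (@cvgy0_le_div _ (`|a| + `|b|)) => x x1.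
have x0 : 0 < x by rewrite (lt_le_trans ltr01).
rewrite normrM normfV (gtr0_norm (sqrDsqr_gt0 x s0)).
rewrite ler_pdivrMr ?sqrDsqr_gt0 // mulrAC ler_pdivlMr //.
rewrite (@le_trans _ _ ((`|a| + `|b|) * x * x)) //.
  rewrite ler_pM2r // (le_trans (ler_normD _ _)) // normrM mulrDl (gtr0_norm x0).
  by rewrite lerD2l ler_peMr.
by rewrite -mulrA ler_wpM2l ?addr_ge0 // -expr2 lerDl sqr_ge0.
Qed.

Lemma cvgy_atan_scaled u v : 0 < v ->
  atan ((x - u) / v) @[x --> +oo] --> (pi / 2 : R).
Proof.
move=> v0; apply: cvg_comp (@cvgy_atan R).
apply/cvgryPge => A; near=> x.
rewrite ler_pdivlMr // lerBrDr.
by near: x; apply: nbhs_pinfty_ge; exact: num_real.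
Unshelve. all: by end_near. Qed.

(** Each logarithm diverges, but the quotient of the two quadratics differs from 1 by an affine
    function over a quadratic. *)
Lemma cvgy_ln_ratio u v s : 0 < v -> 0 < s ->
  ln ((x - u) ^+ 2 + v ^+ 2) - ln (x ^+ 2 + s ^+ 2) @[x --> +oo] --> (0 : R).
Proof.
move=> v0 s0.
rewrite (_ : (fun x => _) = (fun x => ln (1 + (- (2 * u) * x +
    (u ^+ 2 + v ^+ 2 - s ^+ 2)) / (x ^+ 2 + s ^+ 2)))); last first.
  apply/funext => x; rewrite -ln_div ?posrE ?sqrDsqr_gt0 //; congr ln.
  by have := gt_eqF (sqrDsqr_gt0 x s0) => /negbT ?; field.
rewrite -[X in _ --> X]ln1.
apply: continuous_cvg; first exact: continuous_ln.
by rewrite -[X in _ --> X]addr0; apply: cvgD; [exact: cvg_cst|exact: cvgy_affine_div].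
Qed.

Lemma is_derive_atan_scaled u v x : 0 < v ->
  is_derive x (1 : R) (fun x => atan ((x - u) / v)) (v / ((x - u) ^+ 2 + v ^+ 2)).
Proof.
move=> v0.
have dg : is_derive x (1 : R) (fun x => (x - u) / v) v^-1.
  apply: is_derive_eq.
  by rewrite /= subr0 scaler0 add0r; exact: scaler1.
have := @is_derive1_comp _ _ (fun x => (x - u) / v) x _ _ (is_derive1_atan _) dg.
move=> /is_derive_eq; apply.
have v00 : v != 0 by rewrite gt_eqF.
have -> : 1 + ((x - u) / v) ^+ 2 = ((x - u) ^+ 2 + v ^+ 2) / v ^+ 2 by field.
have := gt_eqF (sqrDsqr_gt0 (x - u) v0) => /negbT.
by move: (_ + _) => D D0; field; apply/andP.
Qed.

Lemma is_derive_ln_quad u v x : 0 < v ->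
  is_derive x (1 : R) (fun x => ln ((x - u) ^+ 2 + v ^+ 2))
    (2 * (x - u) / ((x - u) ^+ 2 + v ^+ 2)).
Proof.
move=> v0.
have dg : is_derive x (1 : R) (fun x => (x - u) ^+ 2 + v ^+ 2) (2 * (x - u)).
  apply: is_derive_eq.
  rewrite /=.
  by rewrite ?(scaler1, scaler0, addr0, subr0, add0r); ring.
have := @is_derive1_comp _ _ (fun x => (x - u) ^+ 2 + v ^+ 2) x _ _
  (is_derive1_ln (sqrDsqr_gt0 (x - u) v0)) dg.
by move=> /is_derive_eq; apply; rewrite mulrC.
Qed.

Lemma is_derive_affine_div a b s x : 0 < s ->
  is_derive x (1 : R) (fun x => (a * x + b) / (x ^+ 2 + s ^+ 2))
    ((a * (s ^+ 2 - x ^+ 2) - 2 * b * x) / (x ^+ 2 + s ^+ 2) ^+ 2).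
Proof.
move=> s0.
have := gt_eqF (sqrDsqr_gt0 x s0) => /negbT nz.
have dg : is_derive x (1 : R) (fun x => x ^+ 2 + s ^+ 2) (2 * x).
  apply: is_derive_eq.
  rewrite /=.
  by rewrite ?(scaler1, scaler0, addr0, subr0, add0r); ring.
have da : is_derive x (1 : R) (fun x => a * x + b) a.
  apply: is_derive_eq.
  by rewrite /= ?(scaler1, scaler0, addr0, subr0, add0r); ring.
have dV := @is_deriveV _ (fun x => x ^+ 2 + s ^+ 2) x _ _ nz dg.
have := is_deriveM da dV.
move=> /is_derive_eq; apply.
rewrite /GRing.scale /=.
by field.
Qed.

Variables (lambda : R) (mu1 : probability R R).
Hypotheses (l0 : 0 < lambda) (hmu1 : has_density mu1 (cauchy_pdf lambda)).

Lemma continuous_quad u v : continuous (fun x => (x - u) ^+ 2 + v ^+ 2).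
Proof.
move=> x; apply: cvgD; last exact: cvg_cst.
by rewrite expr2; under eq_fun do rewrite expr2; apply: cvgM;
  (apply: cvgD; [exact: cvg_id|exact: cvg_cst]).
Qed.

Section Moebius.
Variables (a b1 b2 u v : R).
Hypothesis v0 : 0 < v.
(** With [w = u + i v] and [b = b1 + i b2], this is [a] plus the imaginary part of [b / (x - w)]. *)
Let h x := a + (b1 * v + b2 * (x - u)) / ((x - u) ^+ 2 + v ^+ 2).

Let continuous_h : continuous h.
Proof.
move=> x; apply: cvgD; first exact: cvg_cst.
apply: cvgM.
  apply: cvgD; first exact: cvg_cst.
  apply: cvgM; first exact: cvg_cst.
  by apply: cvgD; [exact: cvg_id|exact: cvg_cst].
apply: cvgV; last exact: continuous_quad.
by rewrite gt_eqF // sqrDsqr_gt0.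
Qed.

Let continuous_pdf : continuous (cauchy_pdf lambda).
Proof.
move=> x; apply: cvgM; first exact: cvg_cst.
apply: cvgM; first exact: cvg_cst.
apply: cvgV; first by rewrite gt_eqF // sqrDsqr_gt0.
by have := @continuous_quad 0 lambda x; rewrite /continuous_at subr0; under eq_fun do rewrite subr0.
Qed.

(** The right-hand side is the complex formula behind [h] taken at [x = - i lambda], that is, what
    the residue theorem predicts. *)
Lemma cauchy_moebius_integral : (forall x, 0 <= h x) ->
  (\int[leb]_x (h x * cauchy_pdf lambda x)%:E =
   (a + (b1 * (v + lambda) - b2 * u) / (u ^+ 2 + (v + lambda) ^+ 2))%:E)%E.
Proof.
move=> h0.
have pi0 : (pi : R) != 0 by rewrite gt_eqF // pi_gt0.
have ge0 x : 0 <= h x * cauchy_pdf lambda x.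
  rewrite mulr_ge0 // /cauchy_pdf mulr_ge0 ?invr_ge0 ?pi_ge0 // divr_ge0 ?(ltW l0) //.
  exact/ltW/sqrDsqr_gt0.
have cG : continuous (fun x => h x * cauchy_pdf lambda x).
  by move=> x; apply: cvgM; [exact: continuous_h|exact: continuous_pdf].
(* The primitives come from the partial fraction decomposition, which
   degenerates when the poles [u + i v] and [i lambda] coincide. *)
have nzl x : x ^+ 2 + lambda ^+ 2 != 0 by rewrite gt_eqF ?sqrDsqr_gt0.
have [N0|N0] := eqVneq (u ^+ 2 + (v - lambda) ^+ 2) 0.
  have u0 : u = 0 by move: N0 => /eqP; rewrite paddr_eq0 ?sqr_ge0 // !sqrf_eq0 => /andP[/eqP].
  have vl : v = lambda.
    by move: N0 => /eqP; rewrite paddr_eq0 ?sqr_ge0 // !sqrf_eq0 subr_eq0 => /andP[_ /eqP].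
  pose A1 := a / pi + b1 / (2 * pi * lambda).
  pose F x := A1 * atan ((x - 0) / lambda) +
    (b1 / (2 * pi) * x + - (lambda * b2 / (2 * pi))) / (x ^+ 2 + lambda ^+ 2).
  have dF x : is_derive x (1 : R) F (h x * cauchy_pdf lambda x).
    have d1 := is_derive_atan_scaled 0 x l0.
    have d2 := is_derive_affine_div (b1 / (2 * pi)) (- (lambda * b2 / (2 * pi))) x l0.
    apply: is_derive_eq.
    rewrite /GRing.scale /= /h /A1 /cauchy_pdf u0 vl subr0.
    have l00 : lambda != 0 by rewrite gt_eqF.
    have := nzl x => nz.
    move: (pi : R) pi0 => p p0.
    by field; rewrite nz p0 l00.
  have Fb : F x @[x --> +oo] --> A1 * (pi / 2) + 0.
    apply: cvgD; last exact: cvgy_affine_div.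
    by apply: cvgM; [exact: cvg_cst|exact: cvgy_atan_scaled].
  have Fa : F (- x) @[x --> +oo] --> - (A1 * (pi / 2)) + 0.
    rewrite (_ : (fun x => F (- x)) = fun x => - (A1 * atan ((x - 0) / lambda)) +
      (- (b1 / (2 * pi)) * x + - (lambda * b2 / (2 * pi))) / (x ^+ 2 + lambda ^+ 2)).
      apply: cvgD; last exact: cvgy_affine_div.
      by apply: cvgN; apply: cvgM; [exact: cvg_cst|exact: cvgy_atan_scaled].
    apply/funext => x; rewrite /F !subr0 mulNr atanN sqrrN; congr (_ + (_ + _) / _); ring.
  rewrite (ge0_integral_FTC_line ge0 cG dF Fb Fa); congr EFin.
  rewrite /A1 u0 vl; have l00 : lambda != 0 by rewrite gt_eqF.
  move: (pi : R) pi0 => p p0.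
  have ll0 : lambda + lambda != 0 by rewrite gt_eqF ?addr_gt0.
  by field; rewrite ll0 l00 p0.
pose N1 := u ^+ 2 + (v - lambda) ^+ 2; pose N2 := u ^+ 2 + (v + lambda) ^+ 2.
pose p1 := (b2 * u - b1 * (v - lambda)) / (2 * pi * N1).
pose q1 := - (b1 * u + b2 * (v - lambda)) / (2 * pi * N1).
pose p2 := (b1 * (v + lambda) - b2 * u) / (2 * pi * N2).
pose q2 := (b1 * u + b2 * (v + lambda)) / (2 * pi * N2).
(* The two logarithms carry opposite coefficients because the integrand decays like [x ^- 2], so
   they contribute nothing at infinity. The integral is [pi * (A1 + A2)], in which [p1], with its
   denominator [N1], cancels: [a + 2 * pi * p2] is left. *)
pose A1 := a / pi - p1 + p2; pose A2 := p1 + p2; pose B := (q1 + q2) / 2.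
pose F x := A1 * atan ((x - 0) / lambda) + A2 * atan ((x - u) / v) +
  B * (ln ((x - u) ^+ 2 + v ^+ 2) - ln ((x - 0) ^+ 2 + lambda ^+ 2)).
have N20 : N2 != 0 by rewrite gt_eqF // sqrDsqr_gt0 // addr_gt0.
have dF x : is_derive x (1 : R) F (h x * cauchy_pdf lambda x).
  have d1 := is_derive_atan_scaled u x v0.
  have d2 := is_derive_atan_scaled 0 x l0.
  have d3 := is_derive_ln_quad u x v0.
  have d4 := is_derive_ln_quad 0 x l0.
  apply: is_derive_eq.
  rewrite /GRing.scale /= /h /cauchy_pdf !subr0.
  have nz := nzl x.
  have nzv : (x - u) ^+ 2 + v ^+ 2 != 0 by rewrite gt_eqF ?sqrDsqr_gt0.
  rewrite /A1 /A2 /B /p1 /p2 /q1 /q2 /N1 /N2.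
  rewrite /N2 in N20.
  move: (pi : R) pi0 => p p0.
  by field; rewrite nz p0 nzv N20 N0.
have Fb : F x @[x --> +oo] --> A1 * (pi / 2) + A2 * (pi / 2) + B * 0.
  apply: cvgD; last first.
    apply: cvgM; first exact: cvg_cst.
    by under eq_fun do rewrite [_ - 0]subr0; exact: cvgy_ln_ratio.
  apply: cvgD; apply: cvgM; try exact: cvg_cst; exact: cvgy_atan_scaled.
have Fa : F (- x) @[x --> +oo] --> - (A1 * (pi / 2)) - A2 * (pi / 2) + B * 0.
  rewrite (_ : (fun x => F (- x)) = fun x => - (A1 * atan ((x - 0) / lambda)) -
      A2 * atan ((x - - u) / v) +
      B * (ln ((x - - u) ^+ 2 + v ^+ 2) - ln (x ^+ 2 + lambda ^+ 2))).
    apply: cvgD; last first.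
      by apply: cvgM; [exact: cvg_cst|exact: cvgy_ln_ratio].
    apply: cvgD; apply: cvgN; apply: cvgM; try exact: cvg_cst; exact: cvgy_atan_scaled.
  apply/funext => x; rewrite /F !subr0 opprK -opprD !mulNr !atanN !sqrrN; ring.
rewrite (ge0_integral_FTC_line ge0 cG dF Fb Fa); congr EFin.
rewrite /A1 /A2 /p1 /p2 /N1 /N2; rewrite /N2 in N20.
move: (pi : R) pi0 => p p0.
by field; rewrite N20 p0 N0.
Qed.

Let bound_h x : `|h x| <= `|a| + (`|b1| + `|b2|) / v.
Proof.
rewrite (le_trans (ler_normD _ _)) // lerD2l normrM normfV.
have D0 := sqrDsqr_gt0 (x - u) v0.
rewrite (gtr0_norm D0) ler_pdivrMr // mulrAC ler_pdivlMr //.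
rewrite (le_trans (ler_wpM2r (ltW v0) (ler_normD _ _))) // !normrM (gtr0_norm v0).
set y := `|x - u|; have -> : (x - u) ^+ 2 = y ^+ 2 by rewrite -normrX ger0_norm ?sqr_ge0.
have y0 : 0 <= y by exact: normr_ge0.
rewrite !mulrDl; apply: lerD.
  by rewrite -mulrA ler_wpM2l // -expr2 lerDr sqr_ge0.
rewrite -mulrA ler_wpM2l //.
have := sqr_ge0 (y - v); have := sqr_ge0 y; have := sqr_ge0 v; nra.
Qed.

Lemma cauchy_average : (forall x, 0 <= h x) ->
  (\int[mu1]_x (h x)%:E =
   (a + (b1 * (v + lambda) - b2 * u) / (u ^+ 2 + (v + lambda) ^+ 2))%:E)%E.
Proof.
move=> h0; have mh : measurable_fun setT h by exact: continuous_measurable_fun.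
rewrite (ge0_integral_density hmu1) //; last 2 first.
- exact/measurable_EFinP.
- apply: (@le_lt_trans _ _ (\int[mu1]_x (`|a| + (`|b1| + `|b2|) / v)%:E)%E).
    apply: ge0_le_integral => //.
    + by move=> x _; rewrite lee_fin.
    + exact/measurable_EFinP.
    + by move=> x _; rewrite lee_fin (le_trans (ler_norm _)).
  by rewrite integral_cst //= probability_setT mule1 ltry.
by under eq_integral do rewrite -EFinM; exact: cauchy_moebius_integral.
Qed.

End Moebius.

End Cauchy.

(** * Traces of resolvents *)

Section Complex.
Variable R : realType.
Implicit Types x y : R[i].

Lemma cImD x y : Im (x + y) = Im x + Im y.
Proof. by case: x; case: y. Qed.

Lemma cReD x y : Re (x + y) = Re x + Re y.
Proof. by case: x; case: y. Qed.

Lemma cImM x y : Im (x * y) = Re x * Im y + Im x * Re y.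
Proof. by case: x; case: y. Qed.

Lemma cReM x y : Re (x * y) = Re x * Re y - Im x * Im y.
Proof. by case: x; case: y. Qed.

Lemma cImN x : Im (- x) = - Im x.
Proof. by case: x. Qed.

Lemma cReN x : Re (- x) = - Re x.
Proof. by case: x. Qed.

Lemma cImV x : Im x^-1 = - Im x / (Re x ^+ 2 + Im x ^+ 2).
Proof. by case: x => a b /=; rewrite mulNr. Qed.

Lemma cReV x : Re x^-1 = Re x / (Re x ^+ 2 + Im x ^+ 2).
Proof. by case: x. Qed.

Lemma Im_sum (I : Type) (r : seq I) (P : pred I) (F : I -> R[i]) :
  Im (\sum_(i <- r | P i) F i) = \sum_(i <- r | P i) Im (F i).
Proof. by apply: (big_morph (@complex.Im R)) => //; exact: cImD. Qed.

Lemma Im_conjc x : Im (conjc x) = - Im x.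
Proof. by case: x. Qed.

Lemma Im_eq0_conjc x : conjc x = x -> Im x = 0.
Proof. by case: x => a b [] /eqP; rewrite eq_sym -addr_eq0 -mulr2n mulrn_eq0 => /eqP. Qed.

Lemma conjcM x y : conjc (x * y) = conjc x * conjc y.
Proof. by case: x => a b; case: y => c e; rewrite /GRing.mul /=; congr (_ +i* _)%C; ring. Qed.

Lemma conjcM_real x : conjc x * x = (Re x ^+ 2 + Im x ^+ 2)%:C%C.
Proof. by case: x => a b; rewrite /= /GRing.mul /=; congr (_ +i* _)%C; ring. Qed.

End Complex.

Section Dissipative.
Variables (R : realType) (m : nat) (A : 'M[R]_m).
Hypothesis symA : A^T = A.
Implicit Types (zeta : 'I_m -> R[i]) (u : 'cV[R[i]]_m).

Definition schrodinger zeta : 'M[R[i]]_m :=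
  map_mx (real_complex R) A + diag_mx (\row_i zeta i).

Lemma schrodinger_mulE zeta u k :
  (schrodinger zeta *m u) k 0 = \sum_j (A k j)%:C%C * u j 0 + zeta k * u k 0.
Proof.
rewrite mulmxDl mxE; congr +%R.
  by rewrite mxE; apply: eq_bigr => j _; rewrite mxE.
by rewrite mul_diag_mx !mxE.
Qed.

(** The real symmetric part contributes a real number to the quadratic form, so only the potentials
    survive. Invertibility and the sign of the resolvent both follow from this identity. *)
Lemma Im_schrodinger_form zeta u :
  Im (\sum_k conjc (u k 0) * (schrodinger zeta *m u) k 0) =
  \sum_k Im (zeta k) * (Re (u k 0) ^+ 2 + Im (u k 0) ^+ 2).
Proof.
under eq_bigr do rewrite schrodinger_mulE mulrDr mulr_sumr.
rewrite big_split cImD -[RHS]add0r; congr +%R.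
  apply: Im_eq0_conjc; rewrite rmorph_sum exchange_big /=.
  apply: eq_bigr => k _; rewrite rmorph_sum /=; apply: eq_bigr => j _.
  rewrite !conjcM conjcK (_ : conjc (A k j)%:C%C = (A j k)%:C%C); last first.
    by rewrite -[in RHS]symA mxE /= oppr0.
  by rewrite mulrC -mulrA mulrCA.
rewrite Im_sum; apply: eq_bigr => k _.
by rewrite mulrCA conjcM_real cImM /= mulr0 add0r.
Qed.

Lemma schrodinger_unit zeta : (forall k, Im (zeta k) < 0) ->
  schrodinger zeta \in unitmx.
Proof.
move=> zlt0; rewrite -unitmx_tr -row_free_unit -kermx_eq0.
apply/eqP/row_matrixP => i; rewrite row0.
set v := row i _.
have vM : v *m (schrodinger zeta)^T = 0.
  by apply/sub_kermxP; rewrite row_sub.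
have Mv : schrodinger zeta *m v^T = 0.
  by rewrite -[RHS]trmx0 -vM trmx_mul trmxK.
have /esym/eqP := Im_schrodinger_form zeta v^T.
rewrite Mv [X in Im X]big1 => [|k _]; last by rewrite [X in _ * X]mxE mulr0.
have le0 k : Im (zeta k) * (Re (v^T k 0) ^+ 2 + Im (v^T k 0) ^+ 2) <= 0.
  by rewrite mulr_le0_ge0 ?addr_ge0 ?sqr_ge0 ?ltW.
rewrite -oppr_eq0 -sumrN psumr_eq0; last by move=> k _; rewrite oppr_ge0.
move=> /allP h; apply/rowP => k; have := h k (mem_index_enum _).
rewrite /= (_ : v^T k 0 = v 0 k) ?[v^T _ _]mxE // [RHS]mxE.
rewrite oppr_eq0 mulf_eq0 lt_eqF //= paddr_eq0 ?sqr_ge0 //.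
by rewrite !sqrf_eq0; case: (v 0 k) => a b /= /andP[/eqP-> /eqP->].
Qed.

(** For [u] the [k]-th column of the resolvent, the quadratic form reduces to [conjc (u k 0)]. Hence
    the imaginary part sought is minus a sum of nonpositive terms, and these cannot all vanish
    because [u] is nonzero. *)
Lemma Im_resolvent_diag_gt0 zeta k : (forall k, Im (zeta k) < 0) ->
  0 < Im (invmx (schrodinger zeta) k k).
Proof.
move=> zlt0; set u := col k (invmx (schrodinger zeta)).
have Mu : schrodinger zeta *m u = delta_mx k 0.
  by rewrite /u colE mulmxA mulmxV ?mul1mx // schrodinger_unit.
have := Im_schrodinger_form zeta u.
rewrite Mu (bigD1 k) //= big1 ?addr0; last first.
  by move=> j /negPf jk; rewrite [X in _ * X]mxE jk mulr0.
rewrite !mxE !eqxx mulr1 Im_conjc => /eqP; rewrite eqr_oppLR => /eqP ->.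
rewrite oppr_gt0 lt_neqAle sumr_le0 ?andbT; last first.
  by move=> j _; rewrite mulr_le0_ge0 ?addr_ge0 ?sqr_ge0 ?ltW.
rewrite -oppr_eq0 -sumrN psumr_eq0; last first.
  by move=> j _; rewrite oppr_ge0 mulr_le0_ge0 ?addr_ge0 ?sqr_ge0 ?ltW.
apply/negP => /allP h.
have u0 : u = 0.
  apply/colP => j; have := h j (mem_index_enum _).
  rewrite /= oppr_eq0 mulf_eq0 lt_eqF //= paddr_eq0 ?sqr_ge0 // !sqrf_eq0.
  by rewrite [in RHS]mxE; case: (u _ _) => a b /= /andP[/eqP-> /eqP->].
have /matrixP/(_ k 0) := Mu; rewrite u0 mulmx0 !mxE !eqxx /= => /eqP.
by rewrite eq_sym oner_eq0.
Qed.

Definition im_trace zeta : R := Im (\tr (invmx (schrodinger zeta))).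

Lemma im_trace_ge0 zeta : (forall k, Im (zeta k) < 0) -> 0 <= im_trace zeta.
Proof.
move=> zlt0; rewrite /im_trace /mxtrace Im_sum sumr_ge0 // => k _.
exact/ltW/Im_resolvent_diag_gt0.
Qed.

(* Sherman-Morrison *)
Lemma im_trace_update zeta k t (G := invmx (schrodinger zeta)) :
  (forall k, Im (zeta k) < 0) ->
  1 + t * G k k != 0 ->
  im_trace (fun j => zeta j + (j == k)%:R * t) =
  Im (\tr G - t * (G *m G) k k / (1 + t * G k k)).
Proof.
move=> zlt0 nz; rewrite /im_trace.
have uM := schrodinger_unit zlt0.
have -> : schrodinger (fun j => zeta j + (j == k)%:R * t) =
    schrodinger zeta + t *: delta_mx k k.
  rewrite /schrodinger -addrA; congr +%R; apply/matrixP => i j.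
  rewrite !mxE; have [->|ij] := eqVneq i j; last first.
    rewrite !mulr0n add0r; case: (eqVneq i k) ij => [->|_ _]; last by rewrite mulr0.
    by rewrite eq_sym => /negPf ->; rewrite mulr0.
  by rewrite !mulr1n andbb mulrC.
have dG : delta_mx k k *m G *m delta_mx k k = G k k *: delta_mx k k.
  apply/matrixP => i j; rewrite !mxE (bigD1 k) //= big1 ?addr0; last first.
    by move=> l /negPf lk; rewrite [X in _ * X]mxE lk mulr0.
  rewrite !mxE eqxx (bigD1 k) //= big1 ?addr0; last first.
    by move=> l /negPf lk; rewrite [X in X * _]mxE lk andbF mul0r.
  rewrite !mxE eqxx andbT; case: (i == k); case: (j == k);
    by rewrite /= ?(mul1r, mulr1, mul0r, mulr0).
have -> : invmx (schrodinger zeta + t *: delta_mx k k) =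
   G - (t / (1 + t * G k k)) *: (G *m delta_mx k k *m G).
  set X := _ - _.
  have MX : (schrodinger zeta + t *: delta_mx k k) *m X = 1%:M.
    have SG : schrodinger zeta *m G = 1%:M by exact: mulmxV.
    have SX : schrodinger zeta *m X = 1%:M - (t / (1 + t * G k k)) *: (delta_mx k k *m G).
      by rewrite /X mulmxBr SG -scalemxAr !mulmxA SG mul1mx.
    have DX : delta_mx k k *m X =
        (1 - t / (1 + t * G k k) * G k k) *: (delta_mx k k *m G).
      rewrite /X mulmxBr -scalemxAr !mulmxA dG -scalemxAl scalerA.
      by rewrite scalerBl scale1r.
    rewrite mulmxDl SX -scalemxAl DX scalerA -addrA -scaleNr -scalerDl.
    rewrite [X in X *: _](_ : _ = 0) ?scale0r ?addr0 //.
    by field.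
  have [uX _] := mulmx1_unit MX.
  by rewrite -[RHS](mulKmx uX) MX mulmx1.
rewrite raddfB /= mxtraceZ mxtrace_mulC mulmxA; congr (Im (_ - _)).
rewrite mulrAC; congr (_ * _).
rewrite /mxtrace (bigD1 k) //= big1 ?addr0; last first.
  move=> i ik; rewrite mxE big1 // => l _.
  by rewrite [X in _ * X]mxE (negPf ik) andbF mulr0.
rewrite mxE (bigD1 k) //= big1 ?addr0; last first.
  by move=> l lk; rewrite [X in _ * X]mxE (negPf lk) mulr0.
by congr (_ * _); rewrite [X in _ * X]mxE !eqxx mulr1.
Qed.

Lemma im_trace_update_moebius zeta k : (forall k, Im (zeta k) < 0) ->
  exists (a b1 b2 u v : R), 0 < v /\ forall t : R[i], Im t <= 0 ->
    im_trace (fun j => zeta j + (j == k)%:R * t) =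
    a + (b1 * (v - Im t) + b2 * (Re t - u)) / ((Re t - u) ^+ 2 + (v - Im t) ^+ 2).
Proof.
move=> zlt0; set G := invmx (schrodinger zeta).
have := Im_resolvent_diag_gt0 k zlt0; rewrite -/G.
set g := G k k; set q := (G *m G) k k => g_gt0.
have g0 : g != 0 by apply: contraTneq g_gt0 => ->; rewrite ltxx.
(* [w] is the zero of [1 + t * g], and [b] is the residue there. Since [Im g > 0], the pole lies in
   the upper half plane, away from every admissible [t]. *)
pose w := - g^-1; pose b := q / g ^+ 2.
have w_gt0 : 0 < Im w.
  by rewrite cImN cImV mulNr opprK divr_gt0 // ltr_wpDl ?sqr_ge0 ?exprn_gt0.
exists (Im (\tr G - q / g)), (Re b), (Im b), (Re w), (Im w).
split=> // t t_le0.
have tw : t - w != 0.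
  apply/negP => /eqP/(congr1 (@complex.Im R)); rewrite cImD cImN /= => /eqP.
  by rewrite lt_eqF // subr_lt0 (le_lt_trans t_le0).
have nz : 1 + t * g != 0.
  by rewrite (_ : 1 + t * g = g * (t - w)) ?mulf_neq0 // /w; field.
rewrite im_trace_update // -/G -/g -/q.
rewrite (_ : \tr G - t * q / (1 + t * g) = \tr G - q / g + b / (t - w)); last first.
  by rewrite /b /w; field; rewrite ?g0 ?nz // addrC nz.
rewrite cImD; congr (_ + _).
rewrite cImM cReV cImV cReD cImD cImN cReN.
have dpos : (Re t - Re w) ^+ 2 + (Im t - Im w) ^+ 2 != 0.
  rewrite gt_eqF // ltr_wpDl ?sqr_ge0 // exprn_even_gt0 //=.
  by rewrite subr_eq0 lt_eqF // (le_lt_trans t_le0).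
have -> : (Im w - Im t) ^+ 2 = (Im t - Im w) ^+ 2 by ring.
by field.
Qed.

End Dissipative.

(** * Eigenvalue counts and resolvent traces of a real symmetric matrix *)

Lemma mxrank_diag (F : fieldType) m (d : 'rV[F]_m) :
  \rank (diag_mx d) = (\sum_(i < m) (d 0 i != 0)%R)%N.
Proof.
elim: m d => [|m IH] d.
  by rewrite big_ord0 [diag_mx d]flatmx0 mxrank0.
rewrite (_ : \rank _ = \rank (block_mx (diag_mx (lsubmx (d : 'rV_(1 + m)))) 0 0
    (diag_mx (rsubmx (d : 'rV_(1 + m)))))); last first.
  by rewrite -diag_mx_row hsubmxK.
rewrite rank_diag_block_mx IH big_ord_recl; congr (_ + _)%N.
  rewrite (_ : diag_mx _ = (d 0 0)%:M); last first.
    apply/matrixP => i j; rewrite !ord1 !mxE eqxx mulr1n.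
    by congr (d _ _); apply: val_inj.
  rewrite rank_rV; congr (nat_of_bool (~~ _)).
  by apply/eqP/eqP => [/matrixP/(_ 0 0)|->]; rewrite ?raddf0 // !mxE eqxx mulr1n.
apply: eq_bigr => i _; rewrite mxE; congr (nat_of_bool (d _ _ != 0)).
exact: val_inj.
Qed.

Section Spectral.
Variables (R : realType) (m : nat) (H : 'M[R]_m).
Hypothesis symH : H^T = H.

Local Notation HC := (map_mx (real_complex R) H).

Lemma symmetric_diagonalization :
  exists2 P : 'M[R[i]]_m, P \in unitmx &
  exists l : 'I_m -> R, HC = invmx P *m diag_mx (\row_j (l j)%:C%C) *m P.
Proof.
have hH : HC \is hermsymmx.
  apply/is_hermitianmxP; rewrite expr0 scale1r; apply/matrixP => i j.
  rewrite !mxE -[in LHS]symH mxE.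
  by apply/esym/CrealP/complex_realP; exists (H j i).
exists (spectralmx HC); first exact: spectral_unit.
have /mxOverP rl := hermitian_spectral_diag_real hH.
exists (fun j => Re (spectral_diag HC 0 j)).
rewrite (_ : \row_j _ = spectral_diag HC).
  exact/orthomx_spectralP/hermitian_normalmx.
by apply/rowP => j; rewrite mxE RRe_real.
Qed.

(** A single family [l] links the counting function, in which the density of states is stated, to
    the resolvent trace, on which the averaging acts. The diagonalization lives over [R[i]];
    multiplicities come back to [R] because the rank of a matrix is unchanged by field extension. *)
Lemma spectrum :
  exists l : 'I_m -> R,
    (forall E, eigenvalue_count H E = (\sum_(j < m) (l j <= E)%R)%N) /\
    (forall E eta, 0 < eta ->
      im_trace H (fun=> - (E +i* eta)%C) =
      \sum_j eta / ((l j - E) ^+ 2 + eta ^+ 2)).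
Proof.
have [P uP [l HCE]] := symmetric_diagonalization.
have shiftE (z : R[i]) : HC - z%:M =
    invmx P *m diag_mx (\row_j ((l j)%:C%C - z)) *m P.
  rewrite (_ : diag_mx _ = diag_mx (\row_j (l j)%:C%C) - z%:M); last first.
    by apply/matrixP => i j; rewrite !mxE; case: eqP => _; rewrite ?mulr1n ?mulr0n ?subr0.
  rewrite mulmxBr mulmxBl -HCE; congr (_ - _).
  by rewrite scalar_mxC -mulmxA mulVmx // mulmx1.
have rank_eig a : \rank (eigenspace H a) = (\sum_(j < m) (l j == a)%R)%N.
  rewrite /eigenspace mxrank_ker -(mxrank_map (real_complex R)).
  rewrite map_mxB map_scalar_mx shiftE.
  rewrite -mulmxA (eqmxMfull _ _) ?row_full_unit ?unitmx_inv //.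
  rewrite mxrankMfree ?row_free_unit // mxrank_diag.
  rewrite -[m in (m - _)%N]card_ord -sum1_card -sumnB //; last by move=> j _; case: (_ != _).
  apply: eq_bigr => j _; rewrite mxE -rmorphB /= eq_complex /= eqxx andbT subr_eq0.
  by case: eqP.
have eigP a : reflect (exists j, l j = a) (eigenvalue H a).
  rewrite /eigenvalue -mxrank_eq0 rank_eig sum_nat_eq0.
  apply: (iffP idP) => [|[j la]].
    by rewrite negb_forall => /existsP[j]; rewrite /= eqb0 negbK => /eqP ?; exists j.
  by rewrite negb_forall; apply/existsP; exists j; rewrite /= la eqxx.
exists l; split.
  move=> E; rewrite /eigenvalue_count.
  (* Duplicates are removed because [eigenvalue_count] visits each eigenvalue once and reads its
     multiplicity from the rank of the eigenspace. *)
  pose r := undup (seq.filter (fun a => a <= E) (map l (enum 'I_m))).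
  rewrite (_ : [set a | _] = [set` r]); last first.
    apply/seteqP; split => a /=.
      by move=> [/eigP[j <-] lE]; rewrite mem_undup mem_filter lE map_f // mem_enum.
    by rewrite mem_undup mem_filter => /andP[aE /mapP[j _ aj]]; split => //; apply/eigP; exists j.
  rewrite -fsbig_seq ?undup_uniq //=.
  under eq_bigr do rewrite rank_eig.
  rewrite exchange_big /=; apply: eq_bigr => j _.
  rewrite -(_ : (l j \in r) = (l j <= E)); last first.
    rewrite mem_undup mem_filter; case: (l j <= E) => //=.
    by rewrite map_f // mem_enum.
  rewrite -count_uniq_mem ?undup_uniq // -sum1_count [RHS]big_mkcond /=.
  rewrite [LHS](_ : _ = (\sum_(a <- r) (l j == a))%N) //.
  by apply: eq_bigr => a _; rewrite eq_sym; case: eqP.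
move=> E eta eta_gt0; rewrite /im_trace.
have -> : schrodinger H (fun=> - (E +i* eta)%C) = HC - (E +i* eta)%C%:M.
  by rewrite /schrodinger -raddfN; congr (_ + _); apply/matrixP => i j; rewrite !mxE.
rewrite shiftE.
have lz j : (l j)%:C%C - (E +i* eta)%C != 0.
  by rewrite subr_eq0 eq_complex /= [0 == _]lt_eqF // andbF.
set D := diag_mx _.
pose D' : 'M[R[i]]_m := diag_mx (\row_j ((l j)%:C%C - (E +i* eta)%C)^-1).
have DD' : (invmx P *m D *m P) *m (invmx P *m D' *m P) = 1%:M.
  rewrite !mulmxA mulmxK // -[_ *m D *m D']mulmxA mulmx_diag.
  rewrite (_ : diag_mx _ = 1%:M) ?mulmx1 ?mulVmx //.
  by apply/matrixP => i j; rewrite !mxE mulfV.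
have [u1 _] := mulmx1_unit DD'.
have -> : invmx (invmx P *m D *m P) = invmx P *m D' *m P.
  by rewrite -[RHS](mulKmx u1) DD' mulmx1.
rewrite mxtrace_mulC mulmxA mulmxV // mul1mx mxtrace_diag Im_sum.
apply: eq_bigr => j _; rewrite mxE cImV cImD cReD cImN cReN /= add0r opprK sqrrN.
by [].
Qed.

End Spectral.

(** * Exchanging the single site distribution in finite volume *)

Section ProductLaw.
Variables (R : realType) (m : nat).
Implicit Types (Q : {measure set (m.-tuple R) -> \bar R}) (q : 'I_m -> probability R R).

Definition tuple_box (B : 'I_m -> set R) : set (m.-tuple R) :=
  [set t | forall i, B i (tnth t i)].

Lemma measurable_tuple_box B : (forall i, measurable (B i)) ->
  measurable (tuple_box B).
Proof.
move=> mB; rewrite (_ : tuple_box B =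
    \bigcap_(i in [set: 'I_m]) ((fun t => tnth t i) @^-1` B i)); last first.
  by apply/seteqP; split => [t /= h i _|t h i]; [exact: h|exact: (h i)].
apply: fin_bigcap_measurable => // i _.
by rewrite -[X in measurable X]setTI; exact: measurable_tnth.
Qed.

(** A property rather than a constructed product measure: the law of the potential in a box has it
    by independence, and the values on boxes determine the measure. *)
Definition product_law Q q := forall B : 'I_m -> set R,
  (forall i, measurable (B i)) -> Q (tuple_box B) = (\prod_(i < m) q i (B i))%E.

Lemma product_law_unique Q1 Q2 q : product_law Q1 q -> product_law Q2 q ->
  forall A, measurable A -> Q1 A = Q2 A.
Proof.
move=> h1 h2 A mA.
pose G : set (set (m.-tuple R)) :=
  [set tuple_box B | B in [set B | forall i, measurable (B i)]].
have GT : G setT.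
  by exists (fun=> setT) => //; apply/seteqP; split.
apply: (measure_unique G (fun=> setT)) => //.
- rewrite eqEsubset; split; last first.
    apply: smallest_sub; first exact: sigma_algebra_measurable.
    by move=> _ [B mB <-]; exact: measurable_tuple_box.
  apply: smallest_sub; first exact: smallest_sigma_algebra.
  rewrite -bigcup_seq => _ [i _ [B mB <-]]; apply: sub_sigma_algebra.
  exists (fun j => if j == i then B else setT).
    by move=> j; case: (j == i).
  rewrite setTI; apply/seteqP; split => [t /(_ i)|t /= Bt j].
    by rewrite /= eqxx.
  by have [->|] := eqVneq j i.
- move=> _ _ [B1 mB1 <-] [B2 mB2 <-]; exists (fun i => B1 i `&` B2 i).
    by move=> i; exact: measurableI.
  apply/seteqP; split => [t /= h|t [h1' h2'] i]; last by split; [exact: h1'|exact: h2'].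
  by split => i; have [] := h i.
- by rewrite bigcup_const //; exists 0.
- by move=> _ [B mB <-]; rewrite h1 // h2.
- move=> _; rewrite (_ : setT = tuple_box (fun=> setT)); last first.
    by apply/seteqP; split.
  by rewrite h1 // big1 ?ltry // => i _; exact: probability_setT.
Qed.

Definition tuple_set (k : 'I_m) (p : R * m.-tuple R) : m.-tuple R :=
  [tuple if i == k then p.1 else tnth p.2 i | i < m].

Lemma measurable_tuple_set k : measurable_fun setT (tuple_set k).
Proof.
apply/measurable_fun_tnthP => i.
rewrite (_ : _ \o _ = fun p => if i == k then p.1 else tnth p.2 i); last first.
  by apply/funext => p /=; rewrite tnth_mktuple.
case: (i == k); first exact: measurable_fst.
exact: (measurableT_comp (measurable_tnth _) measurable_snd).
Qed.

HB.instance Definition _ k :=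
  isMeasurableFun.Build _ _ _ _ (tuple_set k) (measurable_tuple_set k).

Lemma product_law_update k (kappa : probability R R)
    (Q : probability (m.-tuple R) R) q :
  product_law Q q ->
  product_law (distribution (kappa \x Q)%E (tuple_set k))
    (fun i => if i == k then kappa else q i).
Proof.
move=> hQ B mB; rewrite /distribution /pushforward /=.
rewrite (_ : _ @^-1` _ =
    B k `*` tuple_box (fun i => if i == k then setT else B i)); last first.
  apply/seteqP; split => [p /= h|p [/= Bk h] i].
    split; first by have := h k; rewrite tnth_mktuple eqxx.
    by move=> i; have := h i; rewrite tnth_mktuple; case: eqP.
  rewrite tnth_mktuple; have [->//|ik] := eqVneq i k.
  by have := h i; rewrite (negPf ik).
rewrite product_measure1E //; last first.
  by apply: measurable_tuple_box => i; case: ifP.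
rewrite hQ => [|i]; last by case: ifP.
rewrite (bigD1 k) //= eqxx probability_setT mul1e [RHS](bigD1 k) //= eqxx.
by congr (_ * _)%E; apply: eq_bigr => i /negPf ->.
Qed.

Lemma ge0_integral_update k (kappa : probability R R)
    (Q : probability (m.-tuple R) R) (f : m.-tuple R -> \bar R) :
  measurable_fun [set: m.-tuple R] f -> (forall t, 0 <= f t)%E ->
  (\int[distribution (kappa \x Q)%E (tuple_set k)]_t f t =
   \int[Q]_t \int[kappa]_x f (tuple_set k (x, t)))%E.
Proof.
move=> mf f0; rewrite ge0_integral_pushforward //=.
rewrite preimage_setT fubini_tonelli2 //.
exact: measurableT_comp.
Qed.

Lemma eq_measure_ge0_integral (Q1 Q2 : {measure set (m.-tuple R) -> \bar R})
    (f : m.-tuple R -> \bar R) :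
  measurable_fun [set: m.-tuple R] f -> (forall t, 0 <= f t)%E ->
  (forall A, measurable A -> Q1 A = Q2 A) ->
  (\int[Q1]_t f t = \int[Q2]_t f t)%E.
Proof.
move=> mf f0 Q12.
by apply: eq_measure_integral => A mA _; exact: Q12.
Qed.

(* The coordinates of law [kappa] are replaced one at a time by coordinates of
   law [kappa'], at each step using only the one-variable identity. *)
Lemma product_law_exchange (kappa kappa' : probability R R)
    (Q Q' : probability (m.-tuple R) R)
    (F : {set 'I_m} -> m.-tuple R -> \bar R) :
  product_law Q (fun=> kappa) -> product_law Q' (fun=> kappa') ->
  (forall S, measurable_fun [set: m.-tuple R] (F S)) -> (forall S t, 0 <= F S t)%E ->
  (forall (S : {set 'I_m}) k t, k \notin S ->
    \int[kappa]_x F S (tuple_set k (x, t)) =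
    \int[kappa']_x F (k |: S)%SET (tuple_set k (x, t)))%E ->
  (\int[Q]_t F finset.set0 t = \int[Q']_t F [set: 'I_m]%SET t)%E.
Proof.
move=> hQ hQ' mF F0 step.
suff [Q'' hQ'' ->] : exists2 Q'' : probability (m.-tuple R) R,
    product_law Q'' (fun=> kappa') &
    (\int[Q]_t F finset.set0 t = \int[Q'']_t F [set: 'I_m]%SET t)%E.
  apply: eq_measure_ge0_integral => // A mA.
  exact: (product_law_unique hQ'').
have main (n : nat) : (n <= m)%N ->
  exists2 Q'' : probability (m.-tuple R) R,
    product_law Q'' (fun i => if (i < n)%N then kappa' else kappa) &
    (\int[Q]_t F finset.set0 t = \int[Q'']_t F [set i : 'I_m | (i < n)%N]%SET t)%E.
  elim: n => [_|n IH nm].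
    by exists Q => //; rewrite (_ : [set i : 'I_m | (i < 0)%N]%SET = finset.set0).
  have [Q1 hQ1 ->] := IH (ltnW nm).
  pose k := Ordinal nm.
  have ltSn (i : 'I_m) : (i < n.+1)%N = (i == k) || (i < n)%N.
    by rewrite ltnS leq_eqVlt -(inj_eq val_inj).
  exists (distribution (kappa' \x Q1)%E (tuple_set k)).
    move=> B mB; rewrite (product_law_update k kappa' hQ1) //.
    apply: eq_bigr => i _; rewrite ltSn.
    by case: eqP.
  (* Resampling coordinate [k] with its own law [kappa] leaves [Q1] unchanged, but exhibits the
     integral over that coordinate, to which [step] applies. Coordinate [k] has index [n], hence
     still law [kappa] under [Q1]. *)
  pose Q2 : probability (m.-tuple R) R := distribution (kappa \x Q1)%E (tuple_set k).
  rewrite (@eq_measure_ge0_integral Q1 Q2) //; last first.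
    apply: (product_law_unique hQ1) => B mB.
    rewrite (product_law_update k kappa hQ1) //.
    apply: eq_bigr => i _; case: eqP => // ->.
    by rewrite /= ltnn.
  rewrite !ge0_integral_update //; apply: eq_integral => t _.
  rewrite step ?finset.inE ?ltnn //; apply: eq_integral => x _.
  congr (F _ _); apply/finset.setP => i; rewrite !finset.inE ltSn.
  by [].
have [Q'' hQ'' E] := main m (leqnn m).
exists Q''.
  by move=> B mB; rewrite hQ'' //; apply: eq_bigr => i _; rewrite ltn_ord.
rewrite E (_ : [set: 'I_m]%SET = [set i : 'I_m | (i < m)%N]%SET) //.
by apply/finset.setP => i; rewrite !finset.inE ltn_ord.
Qed.

End ProductLaw.

(** * Measurability of resolvent traces in the potential *)

Section ComplexMeasurable.
Context {d : measure_display} {T : measurableType d} {R : realType}.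
Implicit Types f g : T -> R[i].

Definition cmeasurable f :=
  measurable_fun [set: T] (fun t => Re (f t)) /\
  measurable_fun [set: T] (fun t => Im (f t)).

Lemma cmeasurable_cst (c : R[i]) : cmeasurable (fun=> c).
Proof. by split. Qed.

Lemma cmeasurableD f g : cmeasurable f -> cmeasurable g ->
  cmeasurable (fun t => f t + g t).
Proof.
move=> [f1 f2] [g1 g2]; split.
  by under eq_fun do rewrite cReD; exact: measurable_funD.
by under eq_fun do rewrite cImD; exact: measurable_funD.
Qed.

Lemma cmeasurableM f g : cmeasurable f -> cmeasurable g ->
  cmeasurable (fun t => f t * g t).
Proof.
move=> [f1 f2] [g1 g2]; split.
  by under eq_fun do rewrite cReM; apply: measurable_funB; exact: measurable_funM.
by under eq_fun do rewrite cImM; apply: measurable_funD; exact: measurable_funM.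
Qed.

Lemma cmeasurableV f : cmeasurable f -> cmeasurable (fun t => (f t)^-1).
Proof.
move=> [f1 f2].
have mV : measurable_fun [set: T] (fun t => (Re (f t) ^+ 2 + Im (f t) ^+ 2)^-1).
  (* As a real power, the inverse is measurable on the whole line; at 0 both sides are 0 by
     convention. *)
  rewrite (_ : (fun t => _) = (fun x => x `^ (-1)) \o
      (fun t => Re (f t) ^+ 2 + Im (f t) ^+ 2)); last first.
    by apply/funext => t /=; rewrite powR_inv1 // addr_ge0 ?sqr_ge0.
  apply: measurableT_comp; first exact: measurable_powR.
  by apply: measurable_funD; exact: measurable_funX.
split.
  by under eq_fun do rewrite cReV; exact: measurable_funM.
by under eq_fun do rewrite cImV; apply: measurable_funM => //; exact: measurableT_comp.
Qed.

Lemma cmeasurable_sum (I : Type) (r : seq I) (F : I -> T -> R[i]) :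
  (forall i, cmeasurable (F i)) -> cmeasurable (fun t => \sum_(i <- r) F i t).
Proof.
move=> mF; elim: r => [|i r IH].
  by under eq_fun do rewrite big_nil; exact: cmeasurable_cst.
by under eq_fun do rewrite big_cons; exact: cmeasurableD.
Qed.

Lemma cmeasurable_prod (I : Type) (r : seq I) (F : I -> T -> R[i]) :
  (forall i, cmeasurable (F i)) -> cmeasurable (fun t => \prod_(i <- r) F i t).
Proof.
move=> mF; elim: r => [|i r IH].
  by under eq_fun do rewrite big_nil; exact: cmeasurable_cst.
by under eq_fun do rewrite big_cons; exact: cmeasurableM.
Qed.

Lemma cmeasurable_det m (M : T -> 'M[R[i]]_m) :
  (forall i j, cmeasurable (fun t => M t i j)) -> cmeasurable (fun t => \det (M t)).
Proof.
move=> mM; apply: cmeasurable_sum => s; apply: cmeasurableM.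
  exact: cmeasurable_cst.
by apply: cmeasurable_prod => i.
Qed.

(** Cramer's rule writes the resolvent as adjugate over determinant, both polynomial in the entries.
    [invmx] unfolds to that formula only on invertible matrices, which the sign of the imaginary
    parts guarantees. *)
Lemma measurable_im_trace m (A : 'M[R]_m) (zeta : T -> 'I_m -> R[i]) :
  A^T = A -> (forall t j, Im (zeta t j) < 0) ->
  (forall j, cmeasurable (fun t => zeta t j)) ->
  measurable_fun [set: T] (fun t => im_trace A (zeta t)).
Proof.
move=> symA zeta0 mz.
have mM i j : cmeasurable (fun t => schrodinger A (zeta t) i j).
  under eq_fun do rewrite !mxE; apply: cmeasurableD; first exact: cmeasurable_cst.
  by case: (i == j); [exact: mz|exact: cmeasurable_cst].
suff [] : cmeasurable (fun t => \tr (invmx (schrodinger A (zeta t)))) by [].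
apply: cmeasurable_sum => k.
under eq_fun do rewrite /invmx (schrodinger_unit symA (zeta0 _)) !mxE.
apply: cmeasurableM.
  by apply: cmeasurableV; exact: cmeasurable_det.
apply: cmeasurableM; first exact: cmeasurable_cst.
apply: cmeasurable_det => i j; under eq_fun do rewrite mxE.
by under eq_fun do rewrite mxE.
Qed.

End ComplexMeasurable.

Lemma measurable_im_trace_shift (R : realType) m (A : 'M[R]_m) (E eta : R) :
  A^T = A -> 0 < eta ->
  measurable_fun [set: m.-tuple R]
    (fun t => im_trace A (fun j => ((tnth t j - E) +i* (- eta))%C)).
Proof.
move=> symA eta0; apply: measurable_im_trace => //.
  by move=> t j; rewrite /= oppr_lt0.
move=> j; split => /=; last exact: measurable_cst.
by apply: measurable_funB => //; exact: measurable_tnth.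
Qed.

Section FiniteVolume.
Variables (R : realType) (lambda : R) (mu1 mu2 kappa : probability R R).
Hypotheses (l0 : 0 < lambda) (hmu1 : has_density mu1 (cauchy_pdf lambda)).
Hypothesis hkappa : forall B, measurable B -> kappa B = convolution mu1 mu2 B.

Lemma ge0_integral_convolution (f : R -> \bar R) :
  measurable_fun [set: R] f -> (forall x, 0 <= f x)%E ->
  (\int[kappa]_x f x = \int[mu2]_y \int[mu1]_x f (x + y)%R)%E.
Proof.
move=> mf f0.
have mD : measurable_fun [set: R * R] (fun p : R * R => p.1 + p.2).
  exact: measurable_funD.
rewrite (@eq_measure_integral _ _ _ _
    (pushforward (mu1 \x mu2)%E (fun p : R * R => p.1 + p.2))) //; last first.
  by move=> B mB _; exact: hkappa.
rewrite ge0_integral_pushforward //= preimage_setT fubini_tonelli2 //.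
exact: measurableT_comp.
Qed.

Section Matrix.
Variables (m : nat) (A : 'M[R]_m) (E eta : R).
Hypotheses (symA : A^T = A) (eta0 : 0 < eta).

(** The sites in [S] are those already treated: their Cauchy part has become the shift
    [- i lambda]. *)
Definition energies (S : {set 'I_m}) (t : m.-tuple R) (j : 'I_m) : R[i] :=
  ((tnth t j - E) +i* (- eta - (j \in S)%:R * lambda))%C.

Lemma Im_energies S t j : Im (energies S t j) < 0.
Proof. by rewrite /= -opprD oppr_lt0 ltr_pwDl // mulr_ge0 // ltW. Qed.

Lemma measurable_im_trace_energies S :
  measurable_fun [set: m.-tuple R] (fun t => im_trace A (energies S t)).
Proof.
apply: measurable_im_trace => //; first exact: Im_energies.
move=> j; split => /=; last exact: measurable_cst.
by apply: measurable_funB => //; exact: measurable_tnth.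
Qed.

Lemma kappa_average (S : {set 'I_m}) k t : k \notin S ->
  (\int[kappa]_x (im_trace A (energies S (tuple_set k (x, t))))%:E =
   \int[mu2]_x (im_trace A (energies (k |: S)%SET (tuple_set k (x, t))))%:E)%E.
Proof.
move=> kS.
(* With coordinate [k] set to 0, both integrands become values of one Moebius function: at the real
   point [x] on the left, at [x - i lambda] on the right. *)
pose zeta0 := energies S (tuple_set k (0, t)).
have z0 j : Im (zeta0 j) < 0 by exact: Im_energies.
have [a [b1 [b2 [u [v [v0 hE]]]]]] := im_trace_update_moebius symA k z0.
have E1 x : im_trace A (energies S (tuple_set k (x, t))) =
    a + (b1 * v + b2 * (x - u)) / ((x - u) ^+ 2 + v ^+ 2).
  rewrite -[X in b1 * X]subr0 -[X in _ / (_ + X ^+ 2)]subr0.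
  rewrite -(hE (x +i* 0)%C) //=; congr im_trace; apply/funext => j.
  rewrite /zeta0 /energies !tnth_mktuple /=; have [->|] := eqVneq j k.
    by rewrite mul1r; apply/eqP; rewrite eq_complex /= ; apply/andP; split; apply/eqP; ring.
  by rewrite mul0r addr0.
have E2 y : im_trace A (energies (k |: S)%SET (tuple_set k (y, t))) =
    a + (b1 * (v + lambda) - b2 * (u - y)) / ((u - y) ^+ 2 + (v + lambda) ^+ 2).
  have := hE (y +i* (- lambda))%C; rewrite /= oppr_le0 opprK => /(_ (ltW l0)).
  have -> : a + (b1 * (v + lambda) - b2 * (u - y)) / ((u - y) ^+ 2 + (v + lambda) ^+ 2)
     = a + (b1 * (v + lambda) + b2 * (y - u)) / ((y - u) ^+ 2 + (v + lambda) ^+ 2).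
    by congr (_ + _ / _); ring.
  move=> <-; congr im_trace; apply/funext => j.
  rewrite /zeta0 /energies !tnth_mktuple /= finset.in_setU1; have [->|] := eqVneq j k.
    rewrite mul1r (negPf kS) /=; apply/eqP; rewrite eq_complex /=.
    by apply/andP; split; apply/eqP; ring.
  by rewrite mul0r addr0.
have mf : measurable_fun [set: R] (fun x => (im_trace A (energies S (tuple_set k (x, t))))%:E).
  apply/measurable_EFinP.
  apply: (measurableT_comp (measurable_im_trace_energies S)).
  apply: (measurableT_comp (measurable_tuple_set k)).
  exact: measurable_fun_pair.
rewrite ge0_integral_convolution //; last first.
  by move=> x; rewrite lee_fin im_trace_ge0 // => j; exact: Im_energies.
apply: eq_integral => y _; rewrite E2.
under eq_integral do rewrite E1.
(* Writing the variable of law [kappa] as a Cauchy part [x] plus an independent [y], the pole seen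
   by [x] is translated from [u] to [u - y]. *)
rewrite -(@cauchy_average _ lambda mu1 l0 hmu1 a b1 b2 (u - y) v v0).
  by apply: eq_integral => x _; congr (_ + (_ + _ * _) / (_ ^+ 2 + _))%:E; ring.
move=> x; rewrite (_ : x - (u - y) = x + y - u); last by ring.
by rewrite -E1 im_trace_ge0 // => j; exact: Im_energies.
Qed.

Lemma expected_im_trace (Q Q2 : probability (m.-tuple R) R) :
  product_law Q (fun=> kappa) -> product_law Q2 (fun=> mu2) ->
  (\int[Q]_t (im_trace A (fun j => ((tnth t j - E) +i* (- eta))%C))%:E =
   \int[Q2]_t (im_trace A (fun j => ((tnth t j - E) +i* (- (eta + lambda)))%C))%:E)%E.
Proof.
move=> hQ hQ2.
have := @product_law_exchange R m kappa mu2 Q Q2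
  (fun S t => (im_trace A (energies S t))%:E) hQ hQ2.
have -> : (fun t => (im_trace A (energies finset.set0 t))%:E) =
    (fun t : m.-tuple R => (im_trace A (fun j => ((tnth t j - E) +i* (- eta))%C))%:E).
  apply/funext => t; congr (im_trace A _)%:E; apply/funext => j.
  by rewrite /energies finset.in_set0 mul0r subr0.
have -> : (fun t => (im_trace A (energies [set: 'I_m]%SET t))%:E) =
    (fun t : m.-tuple R => (im_trace A (fun j => ((tnth t j - E) +i* (- (eta + lambda)))%C))%:E).
  apply/funext => t; congr (im_trace A _)%:E; apply/funext => j.
  by rewrite /energies finset.in_setT mul1r opprD.
apply.
- by move=> S; apply/measurable_EFinP; exact: measurable_im_trace_energies.
- by move=> S t; rewrite lee_fin im_trace_ge0 // => j; exact: Im_energies.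
- exact: kappa_average.
Qed.

End Matrix.
End FiniteVolume.

(** * Density of states *)

Section Box.
Variables (R : realType) (d L : nat).
Implicit Types v : lattice d -> R.

Definition site (j : 'I_#|@box d L|) : lattice d := box_site (enum_val j).

Lemma site_inj : injective site.
Proof.
move=> i j /rowP h; apply: enum_val_inj; apply/ffunP => k.
by have := h k; rewrite !mxE => /addIr [] /val_inj.
Qed.

Lemma card_box : #|@box d L| = (L.*2.+1 ^ d)%N.
Proof. by rewrite card_ffun !card_ord. Qed.

Lemma nearest_neighborC (n k : lattice d) : nearest_neighbor n k = nearest_neighbor k n.
Proof.
by rewrite /nearest_neighbor; congr (_ == _); apply: eq_bigr => i _; rewrite -sqrrN opprB.
Qed.

Lemma laplacian_std_basis (n k : lattice d) :
  lattice_laplacian (std_basis k) n = (nearest_neighbor n k)%:R :> R.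
Proof.
rewrite /lattice_laplacian.
have [nk|nk] := boolP (nearest_neighbor n k).
  rewrite (@fsbigE _ _ _ _ _ [:: k]) //=.
  - by rewrite big_cons big_nil mem_set //= addr0 /std_basis eqxx.
  - by move=> i /=; rewrite inE => /eqP ->.
  - by move=> i _; rewrite inE /std_basis => /negPf ->.
rewrite fsbig1 // => i /= ni; rewrite /std_basis; case: eqP => // ik.
by move: nk; rewrite -ik ni.
Qed.

Definition free_hamiltonian : 'M[R]_#|@box d L| :=
  \matrix_(i, j) (nearest_neighbor (site i) (site j))%:R.

Lemma box_hamiltonianE v i j :
  box_hamiltonian v L i j = free_hamiltonian i j + (i == j)%:R * v (site i).
Proof.
rewrite !mxE /anderson laplacian_std_basis; congr (_ + _).
by rewrite mulrC /std_basis (inj_eq site_inj).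
Qed.

Lemma free_hamiltonian_sym : free_hamiltonian^T = free_hamiltonian.
Proof. by apply/matrixP => i j; rewrite !mxE nearest_neighborC. Qed.

Lemma box_hamiltonian_sym v : (box_hamiltonian v L)^T = box_hamiltonian v L.
Proof.
apply/matrixP => i j; rewrite mxE !box_hamiltonianE.
rewrite -[in LHS]free_hamiltonian_sym [_^T j i]mxE; congr (_ + _).
by rewrite eq_sym; case: eqP => [->//|]; rewrite !mul0r.
Qed.

(** The left side keeps the potential in the complex diagonal, where it can be averaged site by
    site; the right side has one constant energy, as [spectrum] requires. *)
Lemma im_trace_free_hamiltonian v E eta :
  im_trace free_hamiltonian (fun j => ((v (site j) - E) +i* (- eta))%C) =
  im_trace (box_hamiltonian v L) (fun=> - (E +i* eta)%C).
Proof.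
rewrite /im_trace; congr (Im (\tr (invmx _))).
apply/matrixP => i j; rewrite /schrodinger [LHS]mxE [RHS]mxE.
rewrite [map_mx _ _ i j]mxE [in RHS](mxE _ _ i j) box_hamiltonianE.
rewrite !mxE.
have [->|] := eqVneq i j; last by rewrite !mulr0n mul0r !addr0.
rewrite !mulr1n mul1r; apply/eqP; rewrite eq_complex /=; apply/andP; split; apply/eqP; ring.
Qed.

Section Law.
Context {dO : measure_display} {Omega : measurableType dO} (P : probability Omega R).
Variable omega : lattice d -> {RV P >-> R}.

Definition box_potential (w : Omega) : #|@box d L|.-tuple R :=
  [tuple omega (site j) w | j < #|@box d L|].

Lemma measurable_box_potential : measurable_fun setT box_potential.
Proof.
apply/measurable_fun_tnthP => j.
rewrite (_ : _ \o _ = omega (site j)); last first.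
  by apply/funext => w /=; rewrite tnth_mktuple.
exact: measurable_funPT.
Qed.

HB.instance Definition _ := isMeasurableFun.Build _ _ _ _ box_potential measurable_box_potential.

Lemma product_law_box_potential (kappa : probability R R) :
  iid_with_law omega kappa ->
  product_law (distribution P box_potential) (fun=> kappa).
Proof.
move=> [indep law] B mB.
pose s := [seq site j | j <- enum 'I_#|@box d L|].
pose J : {fset lattice d} := [fset x in s]%fset.
(* Independence is stated for sets indexed by lattice sites, so the family [B] is transported along
   [site]; [setT] is the harmless default off the box. *)
pose B' n := if [pick j | site j == n] is Some j then B j else setT.
have B'E j : B' (site j) = B j.
  by rewrite /B'; case: pickP => [k /eqP/site_inj ->//|/(_ j)]; rewrite eqxx.
have := indep J B'.
have -> : (\prod_(i <- J) P (omega i @^-1` B' i))%E = (\prod_(j < #|@box d L|) kappa (B j))%E.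
  rewrite (perm_big s) /=; last first.
    have us : uniq s by rewrite map_inj_uniq ?enum_uniq //; exact: site_inj.
    apply: uniq_perm => //; first exact: fset_uniq.
    by move=> n; rewrite in_fset.
  rewrite big_map big_enum /=; apply: eq_bigr => j _.
  by rewrite B'E; exact: law.
have -> : \bigcap_(i in [set` J]) (omega i @^-1` B' i) = box_potential @^-1` tuple_box B.
  apply/seteqP; split => [w h i|w h n /=].
    have := h (site i); rewrite /= tnth_mktuple B'E; apply.
    by rewrite in_fset map_f // mem_enum.
  rewrite in_fset => /mapP[j _ ->].
  by have := h j; rewrite tnth_mktuple /= B'E.
by apply => i _; rewrite /B'; case: pickP.
Qed.

End Law.
End Box.

(** * Uniform approximation of the Lorentz kernel by step functions *)

Section StepApproximation.
Variable R : realType.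

(** Abel summation: exactly the thresholds from [k] on are active, and their increments
    telescope. *)
Lemma telescope_threshold (phi : R -> R) (t : nat -> R) (n k : nat) (x : R) :
  (k <= n)%N -> (forall i, (i < k)%N -> t i < x) ->
  (forall i, (k <= i < n)%N -> x <= t i) ->
  \sum_(i < n) (phi (t i) - phi (t i.+1)) * (x <= t i)%R%:R = phi (t k) - phi (t n).
Proof.
move=> kn tlt tge.
rewrite -(big_mkord xpredT (fun i => (phi (t i) - phi (t i.+1)) * (x <= t i)%R%:R)).
rewrite (@big_cat_nat _ _ _ k) //= big_nat big1 ?add0r; last first.
  by move=> i /andP[_ ik]; rewrite leNgt tlt // mulr0.
rewrite big_nat (eq_bigr (fun i => - (phi (t i.+1) - phi (t i)))); last first.
  by move=> i ikn; rewrite tge // mulr1 opprB.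
by rewrite -big_nat sumrN telescope_sumr // opprB.
Qed.

(** The approximants are combinations of thresholds because these integrate to values of a
    distribution function. On a grid covering [[- K, K]] the Lipschitz bound controls the error;
    outside, [phi] itself is small. The third [e / 3] pays for [phi (t n)], left over by the
    telescoping. *)
Lemma step_approximation (phi : R -> R) (C : R) :
  (forall x y, `|phi x - phi y| <= C * `|x - y|) ->
  (forall e, 0 < e -> exists K, forall x, K <= `|x| -> `|phi x| <= e) ->
  forall e, 0 < e -> exists n (a t : nat -> R), forall x,
    `|phi x - \sum_(i < n) a i * (x <= t i)%R%:R| <= e.
Proof.
move=> lip van e e0.
have C0 : 0 <= C by have := lip 1 0; rewrite subr0 normr1 mulr1; apply: le_trans.
have e3 : 0 < e / 3 by rewrite divr_gt0.
have [K0 hK0] := van _ e3.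
pose K := Num.max K0 1.
have hK x : K <= `|x| -> `|phi x| <= e / 3.
  by move=> Kx; apply: hK0; rewrite (le_trans _ Kx) // le_max lexx.
have K1 : 0 < K by rewrite lt_max ltr01 orbT.
(* The [+ 1] keeps the mesh positive when [C = 0]. *)
pose delta := e / 3 / (C + 1).
have C1 : 0 < C + 1 by rewrite ltr_wpDl.
have d0 : 0 < delta by rewrite divr_gt0.
have Cd : C * delta <= e / 3.
  by rewrite /delta mulrCA ler_piMr ?(ltW e3) // ler_pdivrMr // mul1r lerDl.
pose t i := - K + i%:R * delta.
pose n := Num.bound (2 * K / delta).
have tn : K <= t n.
  have := archi_boundP (ltW (divr_gt0 (mulr_gt0 (ltr0n _ 2) K1) d0)).
  rewrite -/n ltr_pdivrMr // /t => /ltW; lra.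
have tS i : t i.+1 = t i + delta by rewrite /t -natr1; ring.
have tm i j : (i <= j)%N -> t i <= t j.
  by move=> ij; rewrite /t lerD2l ler_pM2r // ler_nat.
exists n, (fun i => phi (t i) - phi (t i.+1)), t => x.
(* The least such [k] is the first grid point not below [x], capped at [n]; the cap covers points
   beyond the grid, where no threshold is active. *)
have ex : exists k, (n <= k)%N || (x <= t k) by exists n; rewrite leqnn.
case: (ex_minnP ex) => k hk kmin.
have kn : (k <= n)%N by apply: kmin; rewrite leqnn.
rewrite (telescope_threshold phi kn) //; last 2 first.
- move=> i ik; rewrite ltNge; apply/negP => xi.
  by have := kmin i; rewrite xi orbT leqNgt ik => /(_ isT).
- move=> i /andP[ki lin]; move: hk; rewrite leqNgt (leq_ltn_trans ki lin) /= => xk.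
  by rewrite (le_trans xk) // tm.
have phin : `|phi (t n)| <= e / 3.
  by apply: hK; rewrite (le_trans tn) // ler_norm.
have phik : `|phi x - phi (t k)| <= e / 3 + e / 3.
  case: (leP x (t 0%N)) => [x0|x0].
    have -> : k = 0%N by apply/eqP; rewrite -leqn0 kmin // x0 orbT.
    have tK : t 0%N = - K by rewrite /t mul0r addr0.
    rewrite (le_trans (ler_normB _ _)) // lerD // hK //.
      by rewrite ler_normr; apply/orP; right; rewrite lerNr -tK.
    by rewrite tK normrN ler_norm.
  case: (leP x (t k)) => [xk|xk].
    have k0 : (0 < k)%N by case: (k) xk => //; rewrite leNgt x0.
    have xk1 : t k.-1 < x.
      rewrite ltNge; apply/negP => xk1.
      by have := kmin k.-1; rewrite xk1 orbT => /(_ isT); rewrite leqNgt prednK ?leqnn.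
    rewrite (le_trans (lip _ _)) // (le_trans _ (le_trans Cd _)) //; last by lra.
    rewrite ler_wpM2l // ler_norml.
    have := tS k.-1; rewrite prednK // => tk; lra.
  have nk : k = n.
    by apply/eqP; rewrite eqn_leq kn; move: hk; rewrite leNgt xk /= orbF.
  rewrite (le_trans (ler_normB _ _)) // lerD // ?nk //.
  by apply: hK; rewrite (le_trans tn) // -nk (le_trans (ltW xk)) // ler_norm.
have -> : phi x - (phi (t k) - phi (t n)) = (phi x - phi (t k)) + phi (t n) by ring.
rewrite (le_trans (ler_normD _ _)) //.
have -> : e = (e / 3 + e / 3) + e / 3 by field.
by rewrite lerD.
Qed.

(** This is [pi] times the Poisson kernel of the half plane, or the imaginary part of
    [1 / (x - (E + i eta))]. *)
Definition lorentz (E eta x : R) : R := eta / ((x - E) ^+ 2 + eta ^+ 2).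

Lemma lorentz_lipschitz E eta : 0 < eta -> forall x y,
  `|lorentz E eta x - lorentz E eta y| <= eta ^- 2 * `|x - y|.
Proof.
move=> e0 x y; rewrite /lorentz.
set a := x - E; set b := y - E.
have -> : x - y = a - b by rewrite /a /b; ring.
have A0 : 0 < a ^+ 2 + eta ^+ 2 by rewrite ltr_wpDl ?sqr_ge0 ?exprn_gt0.
have B0 : 0 < b ^+ 2 + eta ^+ 2 by rewrite ltr_wpDl ?sqr_ge0 ?exprn_gt0.
have -> : eta / (a ^+ 2 + eta ^+ 2) - eta / (b ^+ 2 + eta ^+ 2) =
    (a - b) * (- (eta * (a + b)) / ((a ^+ 2 + eta ^+ 2) * (b ^+ 2 + eta ^+ 2))).
  by field; rewrite !gt_eqF.
rewrite normrM mulrC ler_wpM2r // normrM normfV normrN.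
rewrite (gtr0_norm (mulr_gt0 A0 B0)).
rewrite ler_pdivrMr ?mulr_gt0 // [leRHS]mulrC ler_pdivlMr ?exprn_gt0 //.
rewrite normrM (gtr0_norm e0).
have : eta * `|a + b| <= a ^+ 2 + b ^+ 2 + eta ^+ 2.
  have [|] := lerP 0 (a + b) => ab; have := sqr_ge0 (eta - `|a + b|);
  have := sqr_ge0 (a - b); have := sqr_ge0 eta; [rewrite ger0_norm //|rewrite ltr0_norm //]; nra.
move=> h; have : eta * `|a + b| * eta ^+ 2 <= (a ^+ 2 + b ^+ 2 + eta ^+ 2) * eta ^+ 2.
  by rewrite ler_pM2r ?exprn_gt0.
move=> /le_trans; apply.
have : 0 <= a ^+ 2 * b ^+ 2 by rewrite mulr_ge0 ?sqr_ge0.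
have -> : (a ^+ 2 + eta ^+ 2) * (b ^+ 2 + eta ^+ 2) =
    (a ^+ 2 + b ^+ 2 + eta ^+ 2) * eta ^+ 2 + a ^+ 2 * b ^+ 2 by ring.
by rewrite lerDl.
Qed.

Lemma lorentz_ge0 E eta x : 0 < eta -> 0 <= lorentz E eta x.
Proof. by move=> e0; rewrite divr_ge0 ?addr_ge0 ?sqr_ge0 // ltW. Qed.

Lemma lorentz_vanish E eta : 0 < eta ->
  forall e, 0 < e -> exists K, forall x, K <= `|x| -> `|lorentz E eta x| <= e.
Proof.
move=> eta0 e e0; exists (`|E| + (eta / e + 1)) => x Kx.
rewrite (ger0_norm (lorentz_ge0 _ _ eta0)) /lorentz.
have D0 : 0 < (x - E) ^+ 2 + eta ^+ 2 by rewrite ltr_wpDl ?sqr_ge0 ?exprn_gt0.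
rewrite ler_pdivrMr // mulrC -ler_pdivrMr //.
have y0 : eta / e + 1 <= `|x - E|.
  by rewrite -(lerD2l `|E|) (le_trans Kx) // addrC -{1}(subrK E x) ler_normD.
have q0 : 0 < eta / e by rewrite divr_gt0.
have -> : (x - E) ^+ 2 = `|x - E| ^+ 2 by rewrite -normrX ger0_norm ?sqr_ge0.
have := sqr_ge0 eta; move: (`|x - E|) y0 => y y0; nra.
Qed.

End StepApproximation.

Section BoundedIntegral.
Context {d : measure_display} {T : measurableType d} {R : realType}.
Variable nu : probability T R.
Implicit Types f g : T -> R.

Lemma bounded_integrable f C : measurable_fun [set: T] f ->
  (forall x, `|f x| <= C) -> nu.-integrable setT (EFin \o f).
Proof.
move=> mf fC; apply: measurable_bounded_integrable => //.
  by rewrite /= probability_setT ltry.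
by exists C; split; [exact: num_real|move=> M CM x _ /=; rewrite (le_trans (fC x)) // ltW].
Qed.

Lemma Rintegral_dist_le f g e :
  nu.-integrable setT (EFin \o f) -> nu.-integrable setT (EFin \o g) ->
  (forall x, `|f x - g x| <= e) -> `|\int[nu]_x f x - \int[nu]_x g x| <= e.
Proof.
move=> intf intg fge.
have intfg : nu.-integrable setT (EFin \o (fun x => f x - g x)).
  by rewrite (_ : _ \o _ = (EFin \o f) \- (EFin \o g))%E //; exact: integrableB.
rewrite -RintegralB // (le_trans (le_normr_Rintegral _ _)) //.
rewrite (@le_trans _ _ (\int[nu]_x e)) //.
  apply: le_Rintegral => //.
  - rewrite (_ : _ \o _ = abse \o (EFin \o (fun x => f x - g x))) //.
    exact: integrable_abse.
  - exact: finite_measure_integrable_cst.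
by rewrite Rintegral_cst //= probability_setT mulr1.
Qed.

End BoundedIntegral.

Section Counting.
Variables (R : realType) (nu : probability R R).

Let F (t : R) : R := fine (nu `]-oo, t]%classic).
Let S (n : nat) (a t : nat -> R) (x : R) := \sum_(i < n) a i * (x <= t i)%R%:R.

Let integrable_step n a t : nu.-integrable setT (EFin \o S n a t) /\
  \int[nu]_x S n a t x = \sum_(i < n) a i * F (t i).
Proof.
elim: n => [|n [IH1 IH2]].
  have -> : S 0 a t = cst 0 by apply/funext => x; rewrite /S big_ord0.
  split; first exact: finite_measure_integrable_cst.
  by rewrite Rintegral_cst // mul0r big_ord0.
have E : S n.+1 a t = fun x => S n a t x + a n * \1_(`]-oo, t n]%classic) x.
  by apply/funext => x; rewrite /S big_ord_recr /= indicE mem_setE in_itv.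
have mI : measurable `]-oo, t n]%classic by exact: measurable_itv.
have i1 : nu.-integrable setT (fun x => (\1_(`]-oo, t n]%classic) x)%:E).
  exact: integrable_indic.
have i2 : nu.-integrable setT (EFin \o (fun x => a n * \1_(`]-oo, t n]%classic) x)).
  rewrite (_ : _ \o _ = fun x => (a n)%:E * (\1_(`]-oo, t n]%classic) x)%:E)%E //.
  exact: integrableZl.
split.
  by rewrite E; exact: (integrableD measurableT IH1 i2).
rewrite E RintegralD // IH2 big_ord_recr /=; congr (_ + _).
by rewrite RintegralZl // /Rintegral integral_indic // setIT.
Qed.

(** For step functions the convergence is that of finitely many distribution values; the uniform
    error passes to both averages since [nu] and the empirical measures have mass 1. *)
Lemma empirical_cvg (phi : R -> R) (m : nat -> nat) (l : forall L, 'I_(m L) -> R)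
    (n : nat -> nat) (a t : nat -> nat -> R) :
  (forall L, 0 < m L)%N ->
  nu.-integrable setT (EFin \o phi) ->
  (forall k x, `|phi x - \sum_(i < n k) a k i * (x <= t k i)%R%:R| <= k.+1%:R^-1) ->
  (forall k i, (fun L => (\sum_(j < m L) (l L j <= t k i)%R)%N%:R / (m L)%:R : R)
     @ \oo --> F (t k i)) ->
  (fun L => (m L)%:R^-1 * \sum_(j < m L) phi (l L j)) @ \oo --> \int[nu]_x phi x.
Proof.
move=> m0 intphi approx cnt; apply/cvgrPdist_le => e e0.
pose k := Num.bound (3 / e).
have ke : k.+1%:R^-1 <= e / 3.
  rewrite -[e / 3]invrK lef_pV2 ?posrE ?ltr0n ?invr_gt0 ?divr_gt0 //.
  rewrite invf_div (le_trans (ltW (archi_boundP _))) ?ler_nat //.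
  by rewrite divr_ge0 ?ltW.
have [intS SE] := integrable_step (n k) (a k) (t k).
have cS : (fun L => (m L)%:R^-1 * \sum_(j < m L) S (n k) (a k) (t k) (l L j)) @ \oo
    --> \int[nu]_x S (n k) (a k) (t k) x.
  rewrite SE.
  rewrite (_ : (fun L => _) = fun L => \sum_(i < n k)
     a k i * ((\sum_(j < m L) (l L j <= t k i)%R)%N%:R / (m L)%:R)); last first.
    apply/funext => L; rewrite exchange_big mulr_sumr; apply: eq_bigr => i _ /=.
    by rewrite -mulr_sumr mulrCA -natr_sum [_ / _]mulrC.
  elim: (n k) => [|p IH].
    by rewrite big_ord0; under eq_fun do rewrite big_ord0; exact: cvg_cst.
  rewrite big_ord_recr; under eq_fun do rewrite big_ord_recr; apply: cvgD => //.
  by apply: cvgM; [exact: cvg_cst|exact: cnt].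
have := cS => /cvgrPdist_le/(_ (e / 3)); rewrite divr_gt0 // => /(_ isT) near_S.
near=> L.
have h1 : `|\int[nu]_x phi x - \int[nu]_x S (n k) (a k) (t k) x| <= e / 3.
  by apply: Rintegral_dist_le => // x; rewrite (le_trans (approx k x)).
have h2 : `|\int[nu]_x S (n k) (a k) (t k) x -
    (m L)%:R^-1 * \sum_(j < m L) S (n k) (a k) (t k) (l L j)| <= e / 3.
  by near: L.
have h3 : `|(m L)%:R^-1 * \sum_(j < m L) S (n k) (a k) (t k) (l L j) -
    (m L)%:R^-1 * \sum_(j < m L) phi (l L j)| <= e / 3.
  have mL : (0 : R) < (m L)%:R by rewrite ltr0n m0.
  rewrite -mulrBr normrM gtr0_norm ?invr_gt0 // mulrC ler_pdivrMr // -sumrB.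
  rewrite (le_trans (ler_norm_sum _ _ _)) //.
  rewrite (@le_trans _ _ (\sum_(j < m L) (e / 3))) //; last first.
    by rewrite sumr_const card_ord mulr_natr.
  by apply: ler_sum => j _; rewrite distrC (le_trans (approx k _)).
rewrite (_ : e = e / 3 + e / 3 + e / 3); last by field.
apply: le_trans (ler_distD _ _ _) (lerD (le_trans (ler_distD _ _ _) (lerD h1 h2)) h3).
Unshelve. all: by end_near. Qed.

End Counting.

(** * Infinite volume limit of the expected resolvent trace *)

Section Limit.
Variables (R : realType) (d : nat).
Context {dO : measure_display} {Omega : measurableType dO} (P : probability Omega R).
Variables (omega : lattice d -> {RV P >-> R}) (nu : probability R R).
Hypothesis hnu : is_dos_measure omega nu.
Variables (E eta : R).
Hypothesis eta0 : 0 < eta.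

Let m L := #|@box d L|.
Let G L (t : (m L).-tuple R) : R :=
  im_trace (@free_hamiltonian R d L) (fun j => ((tnth t j - E) +i* (- eta))%C).

Let m_gt0 L : (0 < m L)%N.
Proof. by rewrite /m card_box expn_gt0. Qed.

Let measurable_G L : measurable_fun [set: (m L).-tuple R] (@G L).
Proof.
exact: (measurable_im_trace_shift E (free_hamiltonian_sym R d L) eta0).
Qed.

Lemma lorentz_le x : `|lorentz E eta x| <= eta^-1.
Proof.
rewrite ger0_norm ?lorentz_ge0 // /lorentz ler_pdivrMr; last first.
  by rewrite ltr_wpDl ?sqr_ge0 ?exprn_gt0.
have e0 : eta != 0 by rewrite gt_eqF.
have -> : eta^-1 * ((x - E) ^+ 2 + eta ^+ 2) = eta^-1 * (x - E) ^+ 2 + eta by field.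
by rewrite lerDr mulr_ge0 ?sqr_ge0 // invr_ge0 ltW.
Qed.

Lemma measurable_lorentz : measurable_fun [set: R] (lorentz E eta).
Proof.
apply: continuous_measurable_fun => x; rewrite /lorentz.
apply: cvgM; first exact: cvg_cst.
apply: cvgV; last exact: continuous_quad.
by rewrite gt_eqF // sqrDsqr_gt0.
Qed.

Lemma dos_lorentz_cvg :
  (\int[distribution P (box_potential L omega)]_t
    (((m L)%:R^-1 * G t)%:E))%E @[L --> \oo] -->
  (\int[nu]_x (lorentz E eta x)%:E)%E.
Proof.
have intphi : nu.-integrable setT (EFin \o lorentz E eta).
  by apply: bounded_integrable; [exact: measurable_lorentz|exact: lorentz_le].
have step k := step_approximation (lorentz_lipschitz E eta0) (lorentz_vanish E eta0)
  (e := k.+1%:R^-1) ltac:(by rewrite invr_gt0 ltr0n).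
have [n hn] := choice step.
have [a ha] := choice hn.
have [t ht] := choice ha.
(* The eigenvalues are chosen separately for each [w], with no measurability claimed; what gets
   integrated is expressed through [G]. *)
have [l hl] : exists l : forall L, Omega -> 'I_(m L) -> R, forall L w,
    (forall e, eigenvalue_count (box_hamiltonian (fun n => omega n w) L) e =
       (\sum_(j < m L) (l L w j <= e)%R)%N) /\
    G (box_potential L omega w) = \sum_j lorentz E eta (l L w j).
  have ex L : exists l : Omega -> 'I_(m L) -> R, forall w,
    (forall e, eigenvalue_count (box_hamiltonian (fun n => omega n w) L) e =
       (\sum_(j < m L) (l w j <= e)%R)%N) /\
    G (box_potential L omega w) = \sum_j lorentz E eta (l w j).
    have /choice[l hl] : forall w, exists l : 'I_(m L) -> R,
      (forall e, eigenvalue_count (box_hamiltonian (fun n => omega n w) L) e =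
         (\sum_(j < m L) (l j <= e)%R)%N) /\
      G (box_potential L omega w) = \sum_j lorentz E eta (l j).
      move=> w; have [l [h1 h2]] := spectrum (@box_hamiltonian_sym R d L (fun n => omega n w)).
      exists l; split => //; rewrite /lorentz -h2 //.
      rewrite -im_trace_free_hamiltonian /G; congr im_trace; apply/funext => j.
      by rewrite tnth_mktuple.
    by exists l.
  by exists (fun L => projT1 (cid (ex L))) => L w; exact: (projT2 (cid (ex L))).
have ae_cvg : \forall w \ae P, (fun L => (m L)%:R^-1 * G (box_potential L omega w)) @ \oo -->
    \int[nu]_x lorentz E eta x.
  have : \forall w \ae P, forall k i, (fun L =>
     (\sum_(j < m L) (l L w j <= t k i)%R)%N%:R / (m L)%:R : R) @ \oo -->
     fine (nu `]-oo, t k i]%classic).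
    (* The exceptional null set of [hnu] depends on the energy; countably many thresholds allow a
       common one. *)
    apply: ae_foralln => k; apply: ae_foralln => i.
    apply: filterS (hnu (t k i)) => w.
    rewrite (_ : (fun L => (\sum_(j < m L) (l L w j <= t k i)%R)%N%:R / (m L)%:R : R) =
      (fun L => (eigenvalue_count (box_hamiltonian (fun n => omega n w) L) (t k i))%:R
         / (L.*2.+1 ^ d)%:R)) //.
    by apply/funext => L; rewrite (hl L w).1; congr (_ / _%:R); exact: card_box.
  apply: filterS => w cw.
  under eq_fun do rewrite (hl _ w).2.
  exact: (empirical_cvg m_gt0 intphi ht cw).
have bound L w : `|(m L)%:R^-1 * G (box_potential L omega w)| <= eta^-1.
  have mL : (0 : R) < (m L)%:R by rewrite ltr0n m_gt0.
  rewrite (hl L w).2 normrM gtr0_norm ?invr_gt0 // mulrC ler_pdivrMr //.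
  rewrite (le_trans (ler_norm_sum _ _ _)) //.
  rewrite (@le_trans _ _ (\sum_(j < m L) eta^-1)) //.
    by apply: ler_sum => j _; exact: lorentz_le.
  by rewrite sumr_const card_ord mulr_natr.
have mGw L : measurable_fun [set: Omega] (fun w => (m L)%:R^-1 * G (box_potential L omega w)).
  apply: measurable_funM => //.
  by apply: (measurableT_comp (@measurable_G L)); exact: measurable_box_potential.
have dist L : (\int[distribution P (box_potential L omega)]_t ((m L)%:R^-1 * G t)%:E =
    \int[P]_w ((m L)%:R^-1 * G (box_potential L omega w))%:E)%E.
  rewrite ge0_integral_pushforward ?preimage_setT //.
  - apply/measurable_EFinP; apply: measurable_funM; first exact: measurable_cst.
    exact: (@measurable_G L).
  - move=> t0 _; rewrite lee_fin mulr_ge0 ?invr_ge0 // im_trace_ge0 //.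
      exact: free_hamiltonian_sym.
    by move=> j; rewrite /= oppr_lt0.
under eq_fun do rewrite dist.
have h1 L : measurable_fun [set: Omega]
    (fun w => ((m L)%:R^-1 * G (box_potential L omega w))%:E).
  exact/measurable_EFinP.
have h2 : measurable_fun [set: Omega] (cst (\int[nu]_x lorentz E eta x)%:E) by [].
have h3 : \forall w \ae P, [set: Omega] w ->
    ((m L)%:R^-1 * G (box_potential L omega w))%:E @[L --> \oo] -->
    cst (\int[nu]_x lorentz E eta x)%:E w.
  by apply: filterS ae_cvg => w cw _; apply/fine_cvgP; split; [exact: nearW|exact: cw].
have h4 : P.-integrable setT (EFin \o cst eta^-1) by exact: finite_measure_integrable_cst.
have h5 : \forall w \ae P, forall L, [set: Omega] w ->
    (`|((m L)%:R^-1 * G (box_potential L omega w))%:E| <= (EFin \o cst (eta^-1)%R) w)%E.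
  by apply: nearW => w L _; rewrite lee_fin.
have [_ _] := dominated_convergence measurableT h1 h2 h3 h4 h5.
rewrite integral_cst //= probability_setT mule1.
by rewrite fineK //; exact: integrable_fin_num.
Qed.

End Limit.

(** * Smoothness of the convolution *)

Section Smooth.
Variables (R : realType) (lambda : R).
Hypothesis l0 : 0 < lambda.

(* With [a = lambda / (x^2 + lambda^2)] and [b = x / (x^2 + lambda^2)] one has
   [a' = - 2 a b] and [b' = a^2 - b^2], so the algebra generated by [a] and [b]
   is stable under derivation; its elements are bounded. *)
Inductive cauchy_algebra : (R -> R) -> Prop :=
| CA_even : cauchy_algebra (fun x => (0 * x + lambda) / (x ^+ 2 + lambda ^+ 2))
| CA_odd : cauchy_algebra (fun x => (1 * x + 0) / (x ^+ 2 + lambda ^+ 2))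
| CA_cst c : cauchy_algebra (fun=> c)
| CA_add f g : cauchy_algebra f -> cauchy_algebra g -> cauchy_algebra (fun x => f x + g x)
| CA_mul f g : cauchy_algebra f -> cauchy_algebra g -> cauchy_algebra (fun x => f x * g x).

Lemma cauchy_algebra_derive f : cauchy_algebra f ->
  exists2 f', cauchy_algebra f' & forall x : R, is_derive x (1 : R) f (f' x).
Proof.
elim => [||c|g h _ [g' Ag' dg] _ [h' Ah' dh]|g h Ag [g' Ag' dg] Ah [h' Ah' dh]].
(* Both generators are spelled as affine over quadratic so that [is_derive_affine_div]
   differentiates either of them. *)
- pose F x := (0 * x + lambda) / (x ^+ 2 + lambda ^+ 2).
  pose H x := (1 * x + 0) / (x ^+ 2 + lambda ^+ 2).
  exists (fun x => -2 * (F x * H x)).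
    by apply: CA_mul; [exact: CA_cst|apply: CA_mul; [exact: CA_even|exact: CA_odd]].
  move=> x; apply: is_derive_eq (is_derive_affine_div 0 lambda x l0) _.
  rewrite /F /H; have := gt_eqF (sqrDsqr_gt0 x l0) => /negbT nz.
  by field.
- pose F x := (0 * x + lambda) / (x ^+ 2 + lambda ^+ 2).
  pose H x := (1 * x + 0) / (x ^+ 2 + lambda ^+ 2).
  exists (fun x => F x * F x + -1 * (H x * H x)).
    apply: CA_add; first by apply: CA_mul; exact: CA_even.
    by apply: CA_mul; [exact: CA_cst|apply: CA_mul; exact: CA_odd].
  move=> x; apply: is_derive_eq (is_derive_affine_div 1 0 x l0) _.
  rewrite /F /H; have := gt_eqF (sqrDsqr_gt0 x l0) => /negbT nz.
  by field.
- by exists (fun=> 0); [exact: CA_cst|move=> x; exact: is_derive_cst].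
- by exists (fun x => g' x + h' x); [exact: CA_add|move=> x; exact: is_deriveD].
- exists (fun x => g x * h' x + h x * g' x).
    by apply: CA_add; apply: CA_mul.
  by move=> x; apply: is_deriveM.
Qed.

Lemma cauchy_algebra_bounded f : cauchy_algebra f -> exists C, forall x, `|f x| <= C.
Proof.
have bnd a b x : `|(a * x + b) / (x ^+ 2 + lambda ^+ 2)| <= `|a| / lambda + `|b| / lambda ^+ 2.
  have D0 := sqrDsqr_gt0 x l0.
  rewrite normrM normfV (gtr0_norm D0) ler_pdivrMr //.
  rewrite (le_trans (ler_normD _ _)) // normrM mulrDl; apply: lerD.
    rewrite -mulrA ler_wpM2l // mulrC ler_pdivlMr //.
    have -> : x ^+ 2 = `|x| ^+ 2 by rewrite -normrX ger0_norm ?sqr_ge0.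
    have := sqr_ge0 (`|x| - lambda); have := sqr_ge0 `|x|; have := sqr_ge0 lambda; nra.
  rewrite mulrAC ler_pdivlMr ?exprn_gt0 // ler_wpM2l // lerDr sqr_ge0 //.
elim => [||c|g h _ [C hC] _ [D hD]|g h _ [C hC] _ [D hD]].
- by eexists => x; exact: bnd.
- by eexists => x; exact: bnd.
- by exists `|c|.
- by exists (C + D) => x; rewrite (le_trans (ler_normD _ _)) // lerD.
- by exists (C * D) => x; rewrite normrM ler_pM.
Qed.

Lemma cauchy_algebra_continuous f : cauchy_algebra f -> continuous f.
Proof.
move=> /cauchy_algebra_derive[f' _ df] x.
by apply/differentiable_continuous/derivable1_diffP; have [] := df x.
Qed.

Lemma cauchy_algebra_pdf : cauchy_algebra (cauchy_pdf lambda).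
Proof.
rewrite (_ : cauchy_pdf lambda = fun x => pi^-1 * ((0 * x + lambda) / (x ^+ 2 + lambda ^+ 2))).
  by apply: CA_mul; [exact: CA_cst|exact: CA_even].
by apply/funext => x; rewrite mul0r add0r.
Qed.

Variable nu : probability R R.

Lemma cauchy_algebra_integrable f x : cauchy_algebra f ->
  nu.-integrable setT (EFin \o (fun y => f (x - y))).
Proof.
move=> Af; have [C fC] := cauchy_algebra_bounded Af.
apply: measurable_bounded_integrable => //.
- by rewrite /= probability_setT ltry.
- apply: continuous_measurable_fun => y.
  apply: continuous_comp; last exact: cauchy_algebra_continuous.
  by apply: cvgB; [exact: cvg_cst|exact: cvg_id].
by exists C; split; [exact: num_real|move=> M CM y _ /=; rewrite (le_trans (fC _)) // ltW].
Qed.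

(** Differentiation under the integral is dominated by a constant, a global bound of [f'], which is
    integrable because [nu] is a probability; the radius 1 of the interval around [x] is thus
    arbitrary. *)
Lemma is_derive_convolve f f' : cauchy_algebra f -> cauchy_algebra f' ->
  (forall x : R, is_derive x (1 : R) f (f' x)) ->
  forall x : R, derivable (convolve f nu) x 1 /\
    (convolve f nu)^`()%classic x = convolve f' nu x.
Proof.
move=> Af Af' df x.
have [C fC] := cauchy_algebra_bounded Af'.
have dsub (y z : R) : is_derive z (1 : R) (fun z => f (z - y)) (f' (z - y)).
  have h : is_derive z (1 : R) (fun z => z - y) 1.
    by apply: is_derive_eq; rewrite subr0.
  have := @is_derive1_comp _ f (fun z => z - y) z _ _ (df (z - y)) h.
  by rewrite mulr1.
have d1E z y : partial1of2 (fun x y => f (x - y)) z y = f' (z - y).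
  by rewrite partial1of2E; have [_] := dsub y z.
have Ix : `]x - 1, x + 1[%classic x.
  by rewrite /= in_itv /= ltrBlDr ltrDl ltr01.
have intf (z : R) : `]x - 1, x + 1[%classic z -> nu.-integrable setT (EFin \o (fun y => f (z - y))).
  by move=> _; exact: cauchy_algebra_integrable.
have derf (z y : R) : `]x - 1, x + 1[%classic z -> [set: R] y -> derivable (fun z => f (z - y)) z 1.
  by move=> _ _; have [] := dsub y z.
have intC : nu.-integrable setT (EFin \o (cst C : R -> R)).
  exact: finite_measure_integrable_cst.
have C0 : forall y : R, 0 <= (cst C : R -> R) y.
  by move=> y; rewrite /= (le_trans _ (fC 0)).
have ub (z y : R) : `]x - 1, x + 1[%classic z -> [set: R] y ->
    `|partial1of2 (fun x y => f (x - y)) z y| <= (cst C : R -> R) y.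
  by move=> _ _; rewrite d1E /=; exact: fC.
split.
  exact: (@derivable_under_integral _ _ _ nu (fun x y => f (x - y)) setT measurableT
    x (x - 1) (x + 1) Ix intf derf (cst C) C0 intC ub).
rewrite /convolve.
rewrite (@differentiation_under_integral _ _ _ nu (fun x y => f (x - y)) setT measurableT
    x (x - 1) (x + 1) Ix intf derf (cst C) C0 intC ub).
by apply: eq_Rintegral => y _; rewrite d1E.
Qed.

Lemma convolve_infinitely_differentiable :
  infinitely_differentiable (convolve (cauchy_pdf lambda) nu).
Proof.
have main n : exists2 f, cauchy_algebra f &
    derive1n n (convolve (cauchy_pdf lambda) nu) = convolve f nu.
  elim: n => [|n [f Af E]]; first by exists (cauchy_pdf lambda) => //; exact: cauchy_algebra_pdf.
  have [f' Af' df] := cauchy_algebra_derive Af.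
  exists f' => //; rewrite derive1nS E; apply/funext => x.
  exact: (is_derive_convolve Af Af' df x).2.
move=> n x; have [f Af ->] := main n.
have [f' Af' df] := cauchy_algebra_derive Af.
exact: (is_derive_convolve Af Af' df x).1.
Qed.

End Smooth.

(** * Stieltjes inversion *)

Section Inversion.
Variable R : realType.
Local Notation leb := (@lebesgue_measure R).
Implicit Types (nu : probability R R) (a b s : R).

Lemma integral_lorentz_energy a b s t : 0 < s -> a < b ->
  (\int[leb]_(E in `[a, b]) (lorentz E s t)%:E =
   (atan ((b - t) / s) - atan ((a - t) / s))%:E)%E.
Proof.
move=> s0 ab.
have dF (E : R) := is_derive_atan_scaled t E s0.
have fE : (fun E => lorentz E s t) = (fun E => s / ((E - t) ^+ 2 + s ^+ 2)).
  by apply/funext => E; rewrite /lorentz -sqrrN opprB.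
under eq_integral do rewrite /lorentz -sqrrN opprB.
have cF : continuous (fun E => atan ((E - t) / s)).
  by move=> E; apply/differentiable_continuous/derivable1_diffP; have [] := dF E.
rewrite (@continuous_FTC2 _ _ (fun E => atan ((E - t) / s))) //.
- apply: continuous_subspaceT => E.
  apply: cvgM; first exact: cvg_cst.
  by apply: cvgV; [rewrite gt_eqF // sqrDsqr_gt0|exact: continuous_quad].
- split; first by move=> E _; have [] := dF E.
  + by apply: cvg_at_right_filter; exact: cF.
  + by apply: cvg_at_left_filter; exact: cF.
- by move=> E _; rewrite derive1E; have [_] := dF E.
Qed.

Lemma measurable_lorentz2 s : 0 < s ->
  measurable_fun [set: measurableTypeR R * R] (fun p : measurableTypeR R * R => lorentz p.1 s p.2).
Proof.
move=> s0; rewrite /lorentz.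
rewrite (_ : (fun p => _) = (fun x => s * x `^ (-1)) \o
  (fun p : measurableTypeR R * R => (p.2 - (p.1 : R)) ^+ 2 + s ^+ 2)); last first.
  by apply/funext => p /=; rewrite powR_inv1 // addr_ge0 ?sqr_ge0.
apply: measurableT_comp.
  by apply: measurable_funM => //; exact: measurable_powR.
apply: measurable_funD => //; apply: measurable_funX; apply: measurable_funB.
  exact: measurable_snd.
exact: measurable_fst.
Qed.

Lemma integral_lorentz_tonelli nu a b s : 0 < s -> a < b ->
  (\int[leb]_(E in `[a, b]) \int[nu]_t (lorentz E s t)%:E =
   \int[nu]_t (atan ((b - t) / s) - atan ((a - t) / s))%:E)%E.
Proof.
move=> s0 ab.
under [RHS]eq_integral do rewrite -integral_lorentz_energy //.
rewrite [LHS]integral_mkcond.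
under [RHS]eq_integral do rewrite integral_mkcond.
have := @fubini_tonelli _ _ _ _ _ leb nu
  (fun p : measurableTypeR R * R => (lorentz p.1 s p.2)%:E * (\1_(`[a, b]%classic) p.1)%:E)%E.
rewrite /=.
have -> : (\int[leb]_x (((fun E => \int[nu]_t (lorentz E s t)%:E) \_ `[a, b]) x) =
   \int[leb]_x \int[nu]_y ((lorentz x s y)%:E * (\1_`[a, b] x)%:E))%E.
  apply: eq_integral => E _; rewrite patchE indicE; case: (_ \in _).
    by under [RHS]eq_integral do rewrite mule1.
  by under [RHS]eq_integral do rewrite mule0; rewrite integral0.
have -> : (\int[nu]_x \int[leb]_x0 ((fun E => (lorentz E s x)%:E) \_ `[a, b]) x0 =
   \int[nu]_y \int[leb]_x ((lorentz x s y)%:E * (\1_`[a, b] x)%:E))%E.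
  apply: eq_integral => t _; apply: eq_integral => E _; rewrite patchE indicE.
  by case: (_ \in _); rewrite ?mule1 ?mule0.
apply.
  apply: emeasurable_funM; first by apply/measurable_EFinP; exact: (measurable_lorentz2 s0).
  apply/measurable_EFinP; apply: (measurableT_comp (measurable_indic _)) => //.
by move=> p; rewrite mule_ge0 ?lee_fin ?lorentz_ge0.
Qed.

Lemma atan_bound (x : R) : `|atan x| <= pi / 2.
Proof. by rewrite ler_norml (ltW (atan_gtNpi2 _)) ltW ?atan_ltpi2. Qed.

Lemma atan_diff_bound (x y : R) : `|atan x - atan y| <= (pi : R).
Proof.
rewrite (le_trans (ler_normB _ _)) //.
by rewrite [leRHS]splitr lerD // atan_bound.
Qed.

Lemma measurable_atan_diff a b s :
  measurable_fun [set: R] (fun t => atan ((b - t) / s) - atan ((a - t) / s)).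
Proof.
have m c : measurable_fun [set: R] (fun t => atan ((c - t) / s)).
  apply: continuous_measurable_fun => t; apply: continuous_comp; last exact: continuous_atan.
  apply: cvgM; last exact: cvg_cst.
  by apply: cvgB; [exact: cvg_cst|exact: cvg_id].
exact: measurable_funB.
Qed.

(* pi times the indicator of ]a, b[, with half weight at the end points *)
Definition window (a b t : R) : R :=
  pi / 2 * (Num.sg (b - t) - Num.sg (a - t)).

Lemma atan_diff_cvg nu a b (eta : nat -> R) (g : R -> R) :
  (forall t, atan ((b - t) / eta n) - atan ((a - t) / eta n) @[n --> \oo] --> g t) ->
  (\int[nu]_t (atan ((b - t) / eta n) - atan ((a - t) / eta n))%:E)%E @[n --> \oo] -->
  (\int[nu]_t (g t)%:E)%E.
Proof.
move=> cg.
apply: (@dominated_cvg _ _ _ nu setT measurableT _ _ (cst (pi : R)%:E)).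
- by move=> n; apply/measurable_EFinP; exact: measurable_atan_diff.
- by move=> t _; apply/fine_cvgP; split; [exact: nearW|exact: cg].
- by [].
- exact: finite_measure_integrable_cst.
- by move=> n t _; rewrite /= lee_fin atan_diff_bound.
Qed.

(** The limit 0 at [c = 0] is the origin of the half weights in [window]. *)
Lemma atan_div_cvg (c : R) : atan (c / n.+1%:R^-1) @[n --> \oo] --> pi / 2 * Num.sg c.
Proof.
have pos (x : R) : 0 < x -> atan (x / n.+1%:R^-1) @[n --> \oo] --> (pi / 2 : R).
  move=> x0; apply: cvg_comp (@cvgy_atan R).
  apply/cvgryPge => A; near=> n.
  rewrite invrK -ler_pdivrMl // (le_trans (ler_norm _)) //.
  near: n; exists (Num.bound `|x^-1 * A|) => // n /= hn.
  rewrite (le_trans (ltW (archi_boundP _))) // ler_nat.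
  exact: (leq_trans hn).
case: (sgrP c) => [->|c0|c0].
- by rewrite mulr0; under eq_fun do rewrite mul0r atan0; exact: cvg_cst.
- by rewrite mulr1; exact: pos.
- rewrite mulrN1 (_ : (fun n => _) = (fun n : nat => - atan (- c / n.+1%:R^-1))).
    by apply: cvgN; apply: pos; rewrite oppr_gt0.
  by apply/funext => n; rewrite mulNr atanN opprK.
Unshelve. all: by end_near. Qed.

Lemma atan_shift_cvg (c s : R) : 0 < s ->
  atan (c / (n.+1%:R^-1 + s)) @[n --> \oo] --> atan (c / s).
Proof.
move=> s0; apply: continuous_cvg; first exact: continuous_atan.
apply: cvgM; first exact: cvg_cst.
apply: cvgV; first by rewrite gt_eqF.
rewrite -[X in _ --> X]add0r; apply: cvgD; last exact: cvg_cst.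
exact: cvg_harmonic.
Qed.

Section Poisson.
Variables (nu nu2 : probability R R) (lambda : R).
Hypothesis l0 : 0 < lambda.
Hypothesis poisson : forall E eta, 0 < eta ->
  (\int[nu]_x (lorentz E eta x)%:E = \int[nu2]_x (lorentz E (eta + lambda) x)%:E)%E.

(** Both sides are limits of one sequence, along heights [eta = n.+1%:R^-1]. On the side of [nu] the
    kernel concentrates; on the side of [nu2] the height stays above [lambda] and the limit is taken
    inside a continuous function. *)
Lemma stieltjes_inversion a b : a < b ->
  (\int[nu]_t (window a b t)%:E =
   \int[leb]_(E in `[a, b]) \int[nu2]_t (lorentz E lambda t)%:E)%E.
Proof.
move=> ab; rewrite integral_lorentz_tonelli //.
have cl := @atan_diff_cvg nu a b (fun n => n.+1%:R^-1) (window a b).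
have cr := @atan_diff_cvg nu2 a b (fun n => n.+1%:R^-1 + lambda)
  (fun t => atan ((b - t) / lambda) - atan ((a - t) / lambda)).
have eqs : (fun n : nat =>
    \int[nu]_t (atan ((b - t) / n.+1%:R^-1) - atan ((a - t) / n.+1%:R^-1))%:E)%E =
    (fun n : nat => \int[nu2]_t (atan ((b - t) / (n.+1%:R^-1 + lambda)) -
       atan ((a - t) / (n.+1%:R^-1 + lambda)))%:E)%E.
  apply/funext => n.
  have n0 : (0 : R) < n.+1%:R^-1 by rewrite invr_gt0 ltr0n.
  rewrite -integral_lorentz_tonelli //.
  under eq_integral do rewrite poisson //.
  by rewrite integral_lorentz_tonelli ?addr_gt0.
rewrite eqs in cl.
apply: (@cvg_unique _ (@ereal_hausdorff R) _ _ _ _ (cl _) (cr _)).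
- by move=> t; rewrite /window mulrBr; apply: cvgB; exact: atan_div_cvg.
- by move=> t; apply: cvgB; exact: atan_shift_cvg.
Qed.

Lemma integral_lorentz_convolve (E : R) :
  (\int[nu2]_t (lorentz E lambda t)%:E = (pi * convolve (cauchy_pdf lambda) nu2 E)%:E)%E.
Proof.
rewrite /convolve -RintegralZl //; last first.
  by apply: (cauchy_algebra_integrable l0); exact: cauchy_algebra_pdf.
have fE : (fun y => pi * cauchy_pdf lambda (E - y)) = lorentz E lambda.
  apply/funext => y; rewrite /cauchy_pdf mulrA mulfV ?gt_eqF ?pi_gt0 // mul1r.
  by rewrite /lorentz -sqrrN opprB.
rewrite /Rintegral; under [in RHS]eq_integral => y _ do rewrite [X in X%:E](congr1 (@^~ y) fE).
rewrite fineK //; apply: integrable_fin_num => //.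
apply: (@bounded_integrable _ _ _ nu2 (lorentz E lambda) lambda^-1).
  exact: measurable_lorentz.
by move=> x; exact: lorentz_le.
Qed.

Lemma measurable_convolve_pdf : measurable_fun [set: R] (convolve (cauchy_pdf lambda) nu2).
Proof.
have h : infinitely_differentiable (convolve (cauchy_pdf lambda) nu2).
  exact: convolve_infinitely_differentiable.
apply: continuous_measurable_fun => x.
by apply/differentiable_continuous/derivable1_diffP; exact: (h 0%N x).
Qed.

Lemma lorentz_bound s (E x : R) : 0 < s -> lorentz E s x <= s^-1.
Proof. by move=> s0; rewrite (le_trans (ler_norm _)) // lorentz_le. Qed.

Lemma window_ge0 a b (t : R) : a < b -> 0 <= window a b t.
Proof.
move=> ab; rewrite /window mulr_ge0 ?divr_ge0 ?pi_ge0 // subr_ge0.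
have [h|h] := ltP 0 (b - t).
  by rewrite (gtr0_sg h); case: sgrP.
have h2 : a - t < 0 by rewrite subr_lt0 (lt_le_trans ab) // -subr_le0.
by rewrite (ltr0_sg h2); case: sgrP.
Qed.

Lemma measurable_window a b : measurable_fun [set: R] (window a b).
Proof.
have msg c : measurable_fun [set: R] (fun t => Num.sg (c - t)).
  rewrite (_ : (fun t => _) = (fun t => \1_(`]-oo, c[%classic) t - \1_(`]c, +oo[%classic) t)).
    by apply: measurable_funB; exact: measurable_indic.
  apply/funext => t; rewrite !indicE !mem_setE !in_itv /= andbT -(subr_gt0 t c) -(subr_lt0 t c).
  by case: sgrP => _; rewrite ?subr0 ?sub0r.
by apply: measurable_funM => //; exact: measurable_funB.
Qed.

Lemma measurable_poisson (D : set (measurableTypeR R)) :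
  measurable_fun D (fun E : measurableTypeR R => \int[nu2]_t (lorentz E lambda t)%:E)%E.
Proof.
rewrite (_ : (fun E => _) = EFin \o (fun E => pi * convolve (cauchy_pdf lambda) nu2 E)); last first.
  by apply/funext => E; exact: integral_lorentz_convolve.
apply/measurable_EFinP/measurable_funTS; apply: measurable_funM; first exact: measurable_cst.
exact: measurable_convolve_pdf.
Qed.

(** The window of radius [e] around [c] takes the value [pi] at [c], while the right side of the
    inversion formula is at most the length [2 * e] times the bound [lambda^-1] of the kernel. *)
Lemma no_atom c : nu [set c] = 0%E.
Proof.
have bnd (e : R) : 0 < e -> (pi%:E * nu [set c] <= (2 * e / lambda)%:E)%E.
  move=> e0.
  have ab : c - e < c + e by rewrite ltrD2l gtrN.
  apply: (@le_trans _ _ (\int[nu]_t (window (c - e) (c + e) t)%:E)%E).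
    rewrite -[X in nu X]setIT -integral_indic // -ge0_integralZl_EFin //; last 2 first.
    - by apply/measurable_EFinP; exact: measurable_indic.
    - exact: pi_ge0.
    apply: ge0_le_integral => //.
    - by move=> t _; rewrite mule_ge0 ?lee_fin ?pi_ge0.
    - by apply: measurable_funeM; apply/measurable_EFinP; exact: measurable_indic.
    - by apply/measurable_EFinP; exact: measurable_window.
    - move=> t _; rewrite -EFinM lee_fin indicE; case: (boolP (t \in _)) => [|_].
        rewrite inE /= => ->; rewrite mulr1 /window.
        rewrite (gtr0_sg (_ : 0 < c + e - c)); last by rewrite addrAC subrr add0r.
        rewrite (ltr0_sg (_ : c - e - c < 0)); last by rewrite addrAC subrr add0r oppr_lt0.
        by rewrite opprK -[1 + 1]/(2%:R) mulfVK.
      by rewrite mulr0 window_ge0.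
  rewrite stieltjes_inversion //.
  apply: (@le_trans _ _ (\int[leb]_(E in `[(c - e)%R, (c + e)%R]) (lambda^-1)%:E)%E).
    apply: ge0_le_integral => //.
    - by move=> E _; apply: integral_ge0 => t _; rewrite lee_fin lorentz_ge0.
    - exact: measurable_poisson.
    - move=> E _.
      apply: (@le_trans _ _ (\int[nu2]_t (lambda^-1)%:E)%E).
        apply: ge0_le_integral => //.
        + by move=> t _; rewrite lee_fin lorentz_ge0.
        + by apply/measurable_EFinP; exact: measurable_lorentz.
        + by move=> t _; rewrite lee_fin lorentz_bound.
      by rewrite integral_cst //= probability_setT mule1.
  rewrite integral_cst //= lebesgue_measure_itv /= lte_fin ab -EFinD -EFinM lee_fin.
  by rewrite le_eqVlt; apply/orP; left; apply/eqP; ring.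
apply/eqP; rewrite eq_le measure_ge0 andbT.
have fin : nu [set c] \is a fin_num by exact: fin_num_measure.
rewrite -(fineK fin) lee_fin leNgt; apply/negP => p0.
have pp : 0 < pi * fine (nu [set c]) by rewrite mulr_gt0 ?pi_gt0.
(* This radius turns the bound on [pi * nu [set c]] into half of that same number. *)
have := bnd (pi * fine (nu [set c]) * lambda / 4).
rewrite divr_gt0 ?(mulr_gt0 pp) // => /(_ isT).
rewrite -{1}(fineK fin) -EFinM lee_fin.
have -> : 2 * (pi * fine (nu [set c]) * lambda / 4) / lambda = pi * fine (nu [set c]) / 2.
  by move: (pi * _) => q; field; rewrite gt_eqF.
lra.
Qed.

Lemma nu_itv_oc a b : a < b ->
  nu `]a, b]%classic = (\int[leb]_(E in `]a, b]) (convolve (cauchy_pdf lambda) nu2 E)%:E)%E.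
Proof.
move=> ab.
have pi0 : (0 : R) <= pi^-1 by rewrite invr_ge0 pi_ge0.
have mw : measurable_fun [set: R] (fun t => (window a b t)%:E).
  by apply/measurable_EFinP; exact: measurable_window.
have -> : nu `]a, b]%classic = (\int[nu]_t (pi^-1%:E * (window a b t)%:E))%E.
  rewrite -[X in nu X]setIT -integral_indic //.
  apply: ae_eq_integral => //.
  - by apply/measurable_EFinP; exact: measurable_indic.
  - exact: measurable_funeM.
  exists [set a; b]; split.
  - by apply: measurableU.
  - apply/eqP; rewrite eq_le measure_ge0 andbT.
    by rewrite (@le_trans _ _ (nu [set a] + nu [set b])%E) //; [exact: measureU2|rewrite !no_atom adde0].
  move=> t /=; apply: contra_notP => /not_orP[/eqP ta /eqP tb] _.
  rewrite -EFinM; congr EFin; rewrite indicE mem_setE in_itv /= /window.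
  have [at_|ta'] := ltP a t.
    rewrite (ltr0_sg (_ : a - t < 0)) ?subr_lt0 // opprK.
    have [tb'|bt] := leP t b.
      have bt0 : 0 < b - t by rewrite subr_gt0 lt_neqAle tb.
      rewrite (gtr0_sg bt0) -[1 + 1]/(2%:R) mulfVK //= mulVf // gt_eqF // pi_gt0 //.
    by rewrite ltr0_sg ?subr_lt0 // addrC subrr !mulr0.
  have ta2 : t < a by rewrite lt_neqAle ta.
  rewrite gtr0_sg ?subr_gt0 ?(lt_trans ta2) // gtr0_sg ?subr_gt0 //.
  by rewrite subrr !mulr0.
rewrite ge0_integralZl_EFin //; last by move=> t _; rewrite lee_fin window_ge0.
rewrite stieltjes_inversion // -integral_itv_obnd_cbnd; last first.
  exact: measurable_poisson.
under eq_integral do rewrite integral_lorentz_convolve.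
have rho0 (E : R) : 0 <= pi * convolve (cauchy_pdf lambda) nu2 E.
  rewrite -lee_fin -integral_lorentz_convolve; apply: integral_ge0 => t _.
  by rewrite lee_fin lorentz_ge0.
rewrite -ge0_integralZl_EFin //; last 2 first.
- by move=> E _; rewrite lee_fin.
- apply/measurable_EFinP/measurable_funTS; apply: measurable_funM => //.
  exact: measurable_convolve_pdf.
by apply: eq_integral => E _; rewrite -EFinM mulrA mulVf ?mul1r // gt_eqF // pi_gt0.
Qed.

Lemma convolve_pdf_ge0 (E : R) : 0 <= convolve (cauchy_pdf lambda) nu2 E.
Proof.
apply: Rintegral_ge0 => y _.
rewrite /cauchy_pdf mulr_ge0 ?invr_ge0 ?pi_ge0 // divr_ge0 ?(ltW l0) //.
exact/ltW/sqrDsqr_gt0.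
Qed.

(** Packaged as a measure so that uniqueness from the half-open intervals, computed in [nu_itv_oc],
    gives all Borel sets. *)
Definition density_measure (B : set R) : \bar R :=
  (\int[leb]_(E in B) (convolve (cauchy_pdf lambda) nu2 E)%:E)%E.

Let density_measure0 : density_measure set0 = 0%E.
Proof. by rewrite /density_measure integral_set0. Qed.

Let density_measure_ge0 B : (0 <= density_measure B)%E.
Proof. by apply: integral_ge0 => E _; rewrite lee_fin convolve_pdf_ge0. Qed.

Let density_measure_sigma_additive : semi_sigma_additive density_measure.
Proof.
apply: (@semi_sigma_additive_nng_induced _ _ _ leb).
  by apply/measurable_EFinP; exact: measurable_convolve_pdf.
by move=> E; rewrite lee_fin convolve_pdf_ge0.
Qed.

HB.instance Definition _ := isMeasure.Build _ R R density_measure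
  density_measure0 density_measure_ge0 density_measure_sigma_additive.

Lemma poisson_has_density : has_density nu (convolve (cauchy_pdf lambda) nu2).
Proof.
split; [exact: measurable_convolve_pdf|exact: convolve_pdf_ge0|move=> B mB].
apply: (measure_unique (@ocitv R) (fun n => `]- n%:R, n%:R]%classic)
  _ _ _ _ nu density_measure) => //.
- exact: ocitvI.
- by move=> i; exact: is_ocitv.
- exact: bigcup_itvT.
- move=> A /ocitvP[->|[[a b] /= ab ->]]; first by rewrite !measure0.
  exact: nu_itv_oc.
- move=> k; apply: (@le_lt_trans _ _ 1%E); rewrite ?ltry //.
  by apply: probability_le1; exact: measurable_itv.
Qed.

End Poisson.

End Inversion.

Theorem corollary1p2 (R : realType) (d : nat) (hd : (1 <= d)%N)
  (lambda : R) (hlambda : 0 < lambda)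
  (mu1 : probability R R) (hmu1 : has_density mu1 (cauchy_pdf lambda))
  (mu2 : probability R R)
  (* the model H with single site distribution mu1 * mu2 *)
  (dO : measure_display) (Omega : measurableType dO) (P : probability Omega R)
  (omega : lattice d -> {RV P >-> R})
  (homega : iid_with_law omega (convolution mu1 mu2))
  (nu : probability R R) (hnu : is_dos_measure omega nu)
  (* the model h with single site distribution mu2 *)
  (dO2 : measure_display) (Omega2 : measurableType dO2)
  (P2 : probability Omega2 R)
  (omega2 : lattice d -> {RV P2 >-> R})
  (homega2 : iid_with_law omega2 mu2)
  (nu2 : probability R R) (hnu2 : is_dos_measure omega2 nu2) :
  has_density nu (convolve (cauchy_pdf lambda) nu2) /\
  infinitely_differentiable (convolve (cauchy_pdf lambda) nu2).
Proof.
split; last exact: convolve_infinitely_differentiable.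
apply: poisson_has_density => // E eta eta0.
(* [convolution] is a bare set function; the law of a single site supplies a probability measure
   with the same values on measurable sets. *)
pose kappa : probability R R := distribution P (omega 0).
have hkappa B : measurable B -> kappa B = convolution mu1 mu2 B.
  by move=> mB; exact: homega.2.
have omega_iid : iid_with_law omega kappa.
  by split=> [|i B mB]; [exact: homega.1|rewrite homega.2 // hkappa].
have lim := dos_lorentz_cvg hnu eta0 (E := E).
have lim2 := dos_lorentz_cvg hnu2 (addr_gt0 eta0 hlambda) (E := E).
apply: (@cvg_unique _ (@ereal_hausdorff R) _ _ _ _ lim).
rewrite (_ : (fun L => _) = (fun L => \int[distribution P2 (box_potential L omega2)]_t
  ((#|@box d L|)%:R^-1 * im_trace (free_hamiltonian R d L)
     (fun j => ((tnth t j - E) +i* (- (eta + lambda)))%C))%:E)%E) //.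
apply/funext => L; have symH := free_hamiltonian_sym R d L.
under eq_integral do rewrite EFinM.
under [RHS]eq_integral do rewrite EFinM.
have etal0 : 0 < eta + lambda by exact: addr_gt0.
rewrite !ge0_integralZl_EFin ?invr_ge0 //.
- by rewrite (expected_im_trace hlambda hmu1 hkappa E symH eta0
    (product_law_box_potential omega_iid) (product_law_box_potential homega2)).
- by move=> t _; rewrite lee_fin im_trace_ge0 // => j; rewrite /= oppr_lt0.
- by apply/measurable_EFinP; exact: measurable_im_trace_shift.
- by move=> t _; rewrite lee_fin im_trace_ge0 // => j; rewrite /= oppr_lt0.
- by apply/measurable_EFinP; exact: measurable_im_trace_shift.
Qed.
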